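(* The operator $L:\operatorname{dom}(L)\subseteq L^2_{\mathbb{X}}\to L^2_{\mathbb{X}}$ is self-adjoint, $-L$ is positive and one has $\sigma(L)=\sigma_p(L)\subseteq-\mathbb{N}_0=\{p\in\mathbb{Z}: p\leq0\}$. Moreover, the eigenspace of $L$ corresponding to an eigenvalue $-p\in\sigma_p(L)$ is precisely the $p$-th Hoeffding space $\mathcal{H}_p$.
   Context: Let $\mathbb{X}=(X_n)_{n\in\mathbb{N}}$ be a sequence of independent random variables on a probability space $(\Omega,\mathcal{A},\mathbb{P})$, $X_n$ taking values in an arbitrary measurable space. Let $\mathcal{F}=\sigma(\mathbb{X})$, $\mathcal{F}_M=\sigma(X_j:j\in M)$, $\mathcal{F}_n=\mathcal{F}_{\{1,\dotsc,n\}}$, $\mathcal{G}_k=\sigma(X_j:j\neq k)$, and let $L^2_{\mathbb{X}}=L^2(\Omega,\mathcal{F},\mathbb{P})$ (real Hilbert space); $\kappa$ is counting measure on $\mathbb{N}$ and $\mathbb{P}_{\mathcal F}$ the restriction of $\mathbb{P}$ to $\mathcal{F}$. Hoeffding spaces: for $F\in L^2_{\mathbb{X}}$ and finite $M\subseteq\mathbb{N}$, $F_M:=\sum_{L\subseteq M}(-1)^{|M|-|L|}\mathbb{E}[F\mid\mathcal{F}_L]$; the $F_M$ are pairwise orthogonal and $F=\sum_{M\text{ finite}}F_M$ unconditionally in $L^2(\mathbb{P})$. For $p\in\mathbb{N}_0$, $\mathcal{H}_p$ is the space of all $F\in L^2_{\mathbb{X}}$ with $F=\sum_{|M|=p}F_M$.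 Malliavin operators: $D_kF:=F-\mathbb{E}[F\mid\mathcal{G}_k]$. On the space $\mathcal{S}$ of all $F\in L^2_{\mathbb{X}}$ that are $\mathcal{F}_n$-measurable for some $n$, put $DF:=(D_kF)_{k\in\mathbb{N}}\in L^2(\kappa\otimes\mathbb{P}_{\mathcal F})$; this is closable and its closure is denoted $D$ with domain $\operatorname{dom}(D)$. Let $\delta$ be the Hilbert space adjoint of $D$, and $\operatorname{dom}(L)=\{F\in\operatorname{dom}(D):DF\in\operatorname{dom}(\delta)\}$, $LF:=-\delta DF$. $L$ self-adjoint means $L=L^*$ (including domains); $-L$ positive means $\mathbb{E}[F(-LF)]\ge0$ for all $F\in\operatorname{dom}(L)$. The spectrum $\sigma(L)$ is the set of all $\lambda\in\mathbb{R}$ such that $L-\lambda\operatorname{Id}:\operatorname{dom}(L)\to L^2_{\mathbb{X}}$ is not bijective; the point spectrum $\sigma_p(L)$ (set of eigenvalues) consists of those $\lambda$ for which it is not injective; the eigenspace of $\lambda\in\sigma_p(L)$ is $\ker(L-\lambda\operatorname{Id})$. *)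

(* Defs.v *)
From HB Require Import structures.
From mathcomp Require Import all_boot all_order all_algebra finmap.
From mathcomp Require Import all_classical all_reals all_analysis.
From mathcomp Require Import summability.

Set Implicit Arguments.
Unset Strict Implicit.
Unset Printing Implicit Defensive.
Import Order.TTheory GRing.Theory Num.Theory.
Import numFieldNormedType.Exports.

Local Open Scope classical_set_scope.
Local Open Scope ring_scope.

(* Elements of L^2(mu) are represented by square-integrable measurable
   functions, and equality in L^2(mu) is equality mu-almost everywhere. An
   unbounded operator L^2(mu) -> L^2(nu) is represented by its graph, the set of
   all pairs (f, g) such that f is in the domain and g is a representative of
   the image of f. *)
Section Operators.
Context (R : realType).

Definition L2 d (T : measurableType d) (mu : {measure set T -> \bar R}) :
  set (T -> R) := [set f | f \in Lfun mu 2%:E].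

Definition L2dist d (T : measurableType d) (mu : {measure set T -> \bar R})
  (f g : T -> R) : \bar R := Lnorm mu 2%:E (fun x => (f x - g x)%:E).

Definition L2inner d (T : measurableType d) (mu : {measure set T -> \bar R})
  (f g : T -> R) : R := \int[mu]_x (f x * g x).

Definition graph (T U : Type) := set ((T -> R) * (U -> R)).

Definition dom (T U : Type) (A : graph T U) : set (T -> R) :=
  [set f | exists g, A (f, g)].

Context d (T : measurableType d) (mu : {measure set T -> \bar R}).
Context d' (U : measurableType d') (nu : {measure set U -> \bar R}).

(* the closure of A in L^2(mu) x L^2(nu) *)
Definition closure_op (A : graph T U) : graph T U :=
  [set fg | [/\ L2 mu fg.1, L2 nu fg.2 &
    exists s : nat -> (T -> R) * (U -> R),
      [/\ forall n, A (s n),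
          (fun n => L2dist mu (s n).1 fg.1) @ \oo --> 0%E &
          (fun n => L2dist nu (s n).2 fg.2) @ \oo --> 0%E]]].

(* h is in the domain of the adjoint, with image k, iff <A f, h> = <f, k> for
   all f in the domain of A; such a k is unique a.e. when dom A is dense. *)
Definition adjoint (A : graph T U) : graph U T :=
  [set hk | [/\ L2 nu hk.1, L2 mu hk.2 &
    forall f g, A (f, g) -> L2inner nu g hk.1 = L2inner mu f hk.2]].

Definition densely_defined (A : graph T U) :=
  forall f, L2 mu f -> forall e : R, 0 < e ->
    exists2 g, dom A g & (L2dist mu f g < e%:E)%E.

End Operators.

Section Spectrum.
Context (R : realType) d (T : measurableType d).
Variables (mu : {measure set T -> \bar R}) (A : graph R T T).

(* The density of the domain is part of self-adjointness: otherwise the adjoint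
   relation is not the graph of an operator. *)
Definition self_adjoint := densely_defined mu A /\ A = adjoint mu mu A.

Definition positive_op := forall f g, A (f, g) -> 0 <= L2inner mu f g.

Definition opp_op : graph R T T :=
  [set fg | A (fg.1, fun x => - fg.2 x)].

(* A - lambda Id *)
Definition shift_op (lambda : R) : graph R T T :=
  [set fh | L2 mu fh.2 /\
    exists2 g, A (fh.1, g) & fh.2 = (fun x => g x - lambda * fh.1 x) %[ae mu]].

Definition injective_op (B : graph R T T) :=
  forall f g h, B (f, h) -> B (g, h) -> f = g %[ae mu].

Definition surjective_op (B : graph R T T) :=
  forall h, L2 mu h -> exists f, B (f, h).

Definition op_spectrum : set R :=
  [set l | ~ (injective_op (shift_op l) /\ surjective_op (shift_op l))].

Definition op_point_spectrum : set R := [set l | ~ injective_op (shift_op l)].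

Definition op_eigenspace (l : R) : set (T -> R) :=
  [set f | shift_op l (f, cst 0)].

End Spectrum.

Section Conditional_expectation.
Context (R : realType) d (T : measurableType d).
Variable mu : {measure set T -> \bar R}.

Definition measurable_wrt (G : set (set T)) (f : T -> R) :=
  forall B, measurable B -> G (f @^-1` B).

Definition is_condexp (G : set (set T)) (f Z : T -> R) :=
  [/\ measurable_wrt G Z,
      mu.-integrable setT (EFin \o Z) &
      forall A, G A -> \int[mu]_(x in A) Z x = \int[mu]_(x in A) f x].

(* a version of E[f | G]; it exists for f integrable, mu a probability and G a
   sub-sigma-algebra *)
Definition condexp (G : set (set T)) (f : T -> R) : T -> R :=
  xget (cst 0) [set Z | is_condexp G f Z].

End Conditional_expectation.

Section Random_sequence.
Context d0 (Omega : measurableType d0) (R : realType) (P : probability Omega R).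
Context (d : nat -> measure_display) (E : forall n, measurableType (d n)).
Variable X : forall n, {RV P >-> E n}.

Definition independent_seq :=
  forall (J : {fset nat}) (A : forall n, set (E n)),
    (forall n, n \in J -> measurable (A n)) ->
    P (\bigcap_(n in [set` J]) (X n @^-1` A n)) =
    (\prod_(n <- J) P (X n @^-1` A n))%E.

Definition gen (M : set nat) : set (set Omega) :=
  \bigcup_(n in M) preimage_set_system setT (X n) measurable.

Definition sigmaX (M : set nat) : set (set Omega) := <<s gen M >>.

(* Omega with the sigma-algebra generated by the whole sequence *)
Definition OmegaX := g_sigma_algebraType (gen setT).

Definition toX : Omega -> OmegaX := idfun.

Lemma measurable_toX : measurable_fun setT toX.
Proof.
move=> _ B; rewrite setTI /= => mB.
suff : <<s gen setT >> `<=` measurable by apply.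
apply: smallest_sub; first exact: sigma_algebra_measurable.
by move=> _ [n _ [C mC <-]]; exact: measurable_funP.
Qed.

HB.instance Definition _ := isMeasurableFun.Build _ _ _ _ toX measurable_toX.

(* the restriction of P to sigma(X) *)
Definition PX := distribution P toX.

(* counting measure on nat times PX *)
Definition kPX := (@counting nat R \x PX)%E.

Definition cond (M : set nat) : (OmegaX -> R) -> (OmegaX -> R) :=
  condexp PX (sigmaX M).

Definition hoeffding_component (F : OmegaX -> R) (M : {fset nat}) :
  OmegaX -> R := fun w =>
  \sum_(L <- fpowerset M) (-1) ^+ (#|` M| - #|` L|) * cond [set` L] F w.

(* F is the unconditional sum of its components of order p, i.e., the limit in
   L^2 along the net of finite sets of such components. *)
Definition hoeffding_space (p : nat) : set (OmegaX -> R) :=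
  [set F | L2 PX F /\
    (fun A : {fset {fset nat}} =>
      L2dist PX F
        (fun w => \sum_(M <- A | #|` M| == p) hoeffding_component F M w))
    @ totally --> 0%E].

Definition malliavinDk (k : nat) (F : OmegaX -> R) : OmegaX -> R :=
  fun w => F w - cond [set j | j != k] F w.

Definition smooth : set (OmegaX -> R) :=
  [set F | L2 PX F /\
    exists n F', measurable_wrt (sigmaX [set j | (j < n)%N]) F' /\
      F = F' %[ae PX]].

Definition malliavinD0 : graph R OmegaX (nat * OmegaX)%type :=
  [set Fu | [/\ smooth Fu.1, L2 kPX Fu.2 &
    forall k, (fun w => Fu.2 (k, w)) = malliavinDk k Fu.1 %[ae PX]]].

Definition malliavinD : graph R OmegaX (nat * OmegaX)%type :=
  closure_op PX kPX malliavinD0.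

Definition malliavin_delta : graph R (nat * OmegaX)%type OmegaX :=
  adjoint PX kPX malliavinD.

Definition malliavinL : graph R OmegaX OmegaX :=
  [set FG | exists2 u, malliavinD (FG.1, u) &
    malliavin_delta (u, fun w => - FG.2 w)].

End Random_sequence.

Arguments PX {d0 Omega R P d E} X.
Arguments kPX {d0 Omega R P d E} X.
Arguments hoeffding_space {d0 Omega R P d E} X p.
Arguments malliavinL {d0 Omega R P d E} X.

(* Main.v *)
Require Import Defs.
From HB Require Import structures.
From mathcomp Require Import all_boot all_order all_algebra finmap.
From mathcomp Require Import generic_quotient.
From mathcomp Require Import all_classical all_reals all_analysis.
From mathcomp Require Import measurable_realfun summability.
From mathcomp Require Import ring lra.

(** The proof moves everything into the Hilbert space H of classes of
    square-integrable functions, where a.e. equality is equality.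

    Independence enters once. On the indicator of a cylinder, the conditional
    expectation Q_A given (X_j), j in A, replaces each factor with index outside
    A by its probability (condE_cylinder). Cylinders are total in H, hence
    Q_A Q_B = Q_(A `&` B) for all sets A and B (condE_comp), and the Q_n given
    X_0, ..., X_(n-1) increase to the identity (condE_total, Qn_cvg).

    What remains is algebra of commuting orthogonal projections. The alternating
    sums hoef M of the Q_L, L a subset of M, are mutually orthogonal projections
    (hoef_hoefE), they add up to Q_n when M ranges over the subsets of
    {0, ..., n-1} (QnE, by Moebius inversion), and D_k = 1 - Q_({k}^c) fixes or
    kills the range of hoef M according to whether k is in M (diffop_hoef). So
    the sum of the D_k Q_n, k < n, is the sum of the #|M| hoef M over these M
    (sum_diffop), which identifies L: the pair (x, y) is in the graph of L iff
    hoef M y = - #|M| hoef M x for every finite M (generatorE). Two limits are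
    needed there: the closure of D is the set of pairs (x, u) with u_k = D_k x
    for all k (gradientP, by dominated convergence for series), and membership
    of x in dom D follows from the bound by - <x, y> of the sums of the
    squared norms of the D_k x.

    L is thus diagonal, and all assertions can be read off. Testing against
    vectors hoef M z shows that a pair in the adjoint graph satisfies the same
    relations (generator_adj). An eigenvector for l has hoef M x = 0 unless
    l = - #|M| (hoef_eigenP), which locates the point spectrum and describes the
    eigenspaces (hoef_eigen_net). If l is not an eigenvalue, the numbers
    - #|M| - l that matter are bounded away from 0, so L - l is inverted by a
    bounded multiplier on the components (generator_surj).

    The analysis underneath consists of the completeness of L2 (riesz_fischer),
    conditional expectation as orthogonal projection (condexpP), a monotone class
    argument for totality (total_pi_system), and Tonelli's theorem for counting
    measure, by which L2 of the product is the Hilbert sum of countably many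
    copies of H (component_sum, component_ex). *)

Set Implicit Arguments.
Unset Strict Implicit.
Unset Printing Implicit Defensive.
Import Order.TTheory GRing.Theory Num.Theory.
Import numFieldNormedType.Exports.

Local Open Scope classical_set_scope.
Local Open Scope ring_scope.

(* Convergence along the net of finite sets uses that this is a filter. *)
#[local] Existing Instance totally_filter.

(** * Real Hilbert spaces *)

Section RealSequences.
Context (R : realType).
Implicit Types (u v : nat -> R) (a b c : R).

Lemma rcvgD u v a b : u @ \oo --> a -> v @ \oo --> b ->
  (fun n => u n + v n) @ \oo --> a + b.
Proof. by move=> ua vb; exact: (@cvgD _ R^o _ _ _ u v). Qed.

Lemma rcvg_cst a : (fun _ : nat => a) @ \oo --> a.
Proof. exact: cvg_cst. Qed.

Lemma rcvgB u v a b : u @ \oo --> a -> v @ \oo --> b ->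
  (fun n => u n - v n) @ \oo --> a - b.
Proof. by move=> ua vb; exact: (@cvgB _ R^o _ _ _ u v). Qed.

Lemma rcvgZ u a c : u @ \oo --> a -> (fun n => c * u n) @ \oo --> c * a.
Proof. by move=> ua; exact: (@cvgM _ _ _ _ (cst c) u _ _ (cvg_cst _) ua). Qed.

Lemma eq_rcvg u v a b : u =1 v -> a = b -> u @ \oo --> a -> v @ \oo --> b.
Proof. by move=> /funext -> ->. Qed.

Lemma rcvg_unique u a b : u @ \oo --> a -> u @ \oo --> b -> a = b.
Proof. exact: (@cvg_unique _ (@Rhausdorff R)). Qed.

End RealSequences.
Arguments rcvgZ {R u a} c _.
Arguments rcvg_cst {R} a.

(** Definiteness makes Leibniz equality the equality of vectors, so that
    identities between operators can be rewritten. Completeness is phrased with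
    squared norms, which avoids square roots. *)
Record hilbert (R : realType) := Hilbert {
  hilbert_lmod :> lmodType R;
  ip : hilbert_lmod -> hilbert_lmod -> R;
  ipC : forall x y, ip x y = ip y x;
  ipDl : forall x y z, ip (x + y) z = ip x z + ip y z;
  ipZl : forall a x y, ip (a *: x) y = a * ip x y;
  ip_ge0 : forall x, 0 <= ip x x;
  ip_eq0 : forall x, ip x x = 0 -> x = 0;
  ip_complete : forall s : nat -> hilbert_lmod,
    (forall e, 0 < e -> exists N, forall m n, (N <= m)%N -> (N <= n)%N ->
      ip (s m - s n) (s m - s n) < e) ->
    exists x, (fun n => ip (s n - x) (s n - x)) @ \oo --> (0 : R) }.

Section HilbertTheory.
Context (R : realType) (H : hilbert R).
Implicit Types (x y z : H) (a : R) (s : nat -> H).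

Definition hcvg s x := (fun n => ip (s n - x) (s n - x)) @ \oo --> (0 : R).

Lemma ipDr x y z : ip x (y + z) = ip x y + ip x z.
Proof. by rewrite ipC ipDl ![ip _ x]ipC. Qed.

Lemma ipZr a x y : ip x (a *: y) = a * ip x y.
Proof. by rewrite ipC ipZl ipC. Qed.

Lemma ipNl x y : ip (- x) y = - ip x y.
Proof. by rewrite -scaleN1r ipZl mulN1r. Qed.

Lemma ipNr x y : ip x (- y) = - ip x y.
Proof. by rewrite ipC ipNl ipC. Qed.

Lemma ipBl x y z : ip (x - y) z = ip x z - ip y z.
Proof. by rewrite ipDl ipNl. Qed.

Lemma ipBr x y z : ip x (y - z) = ip x y - ip x z.
Proof. by rewrite ipDr ipNr. Qed.

Lemma ip0l x : ip 0 x = 0.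
Proof. by rewrite -(scale0r 0) ipZl mul0r. Qed.

Lemma ip0r x : ip x 0 = 0.
Proof. by rewrite ipC ip0l. Qed.

Lemma ip_suml I (r : seq I) (p : pred I) (f : I -> H) y :
  ip (\sum_(i <- r | p i) f i) y = \sum_(i <- r | p i) ip (f i) y.
Proof.
elim/big_rec2: _ => [|i u v _ <-]; first exact: ip0l.
by rewrite ipDl.
Qed.

Lemma ip_sumr I (r : seq I) (p : pred I) (f : I -> H) y :
  ip y (\sum_(i <- r | p i) f i) = \sum_(i <- r | p i) ip y (f i).
Proof. by rewrite ipC ip_suml; apply: eq_bigr => i _; rewrite ipC. Qed.

Lemma ip_inj x y : (forall z, ip x z = ip y z) -> x = y.
Proof.
move=> xy; apply/eqP; rewrite -subr_eq0; apply/eqP/ip_eq0.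
by rewrite ipBl xy subrr.
Qed.

Lemma ip_sqrD x y : ip (x + y) (x + y) = ip x x + 2 * ip x y + ip y y.
Proof. by rewrite ipDl !ipDr (ipC y x); ring. Qed.

Lemma ip_sqrB x y : ip (x - y) (x - y) = ip x x - 2 * ip x y + ip y y.
Proof. by rewrite ip_sqrD !ipNr ipNl; ring. Qed.

Lemma ip_distC x y : ip (x - y) (x - y) = ip (y - x) (y - x).
Proof. by rewrite -opprB ipNl ipNr opprK. Qed.

Lemma cauchy_schwarz x y : ip x y ^+ 2 <= ip x x * ip y y.
Proof.
have [y0|y0] := eqVneq (ip y y) 0.
  by rewrite (ip_eq0 y0) !ip0r mulr0 expr0n.
have yp : 0 < ip y y by rewrite lt_def y0 ip_ge0.
have := ip_ge0 (ip y y *: x - ip x y *: y).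
rewrite ip_sqrB !ipZl !ipZr.
rewrite (_ : _ + _ = ip y y * (ip x x * ip y y - ip x y ^+ 2)); last by ring.
by rewrite pmulr_rge0// subr_ge0.
Qed.

Lemma ip_norm_le x y : `|ip x y| <= Num.sqrt (ip x x) * Num.sqrt (ip y y).
Proof.
rewrite -sqrtrM ?ip_ge0// -sqrtr_sqr ler_sqrt ?cauchy_schwarz//.
by rewrite mulr_ge0 ?ip_ge0.
Qed.

Lemma hcvg_ipl s x y : hcvg s x -> (fun n => ip (s n) y) @ \oo --> ip x y.
Proof.
move=> sx.
suff h : (fun n => ip (s n) y - ip x y) @ \oo --> (0 : R).
  apply: eq_rcvg (rcvgD h (rcvg_cst (ip x y))); last by rewrite add0r.
  by move=> n /=; rewrite subrK.
apply/norm_cvg0P.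
apply: (@squeeze_cvgr _ _ _ _ (cst 0)
  (fun n => Num.sqrt (ip (s n - x) (s n - x)) * Num.sqrt (ip y y))).
- by near=> n; rewrite normr_ge0 -ipBl ip_norm_le.
- exact: cvg_cst.
- rewrite -[X in _ --> X](mul0r (Num.sqrt (ip y y))); apply: cvgM; last exact: cvg_cst.
  rewrite -sqrtr0; apply: (@cvg_comp _ _ _ _ Num.sqrt _ _ _ sx).
  exact: sqrt_continuous.
Unshelve. all: by end_near. Qed.

Arguments hcvg_ipl {s x} y _.

Lemma hcvg_ipr s x y : hcvg s x -> (fun n => ip y (s n)) @ \oo --> ip y x.
Proof.
move=> /(hcvg_ipl y); rewrite ipC.
by under eq_fun do rewrite ipC.
Qed.

Arguments hcvg_ipr {s x} y _.

Lemma hcvg_sqr s x y : hcvg s x ->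
  (fun n => ip (s n - y) (s n - y)) @ \oo --> ip (x - y) (x - y).
Proof.
move=> sx.
have sx0 : (fun n => ip (s n - x) (s n - x)) @ \oo --> (0 : R) := sx.
have h := rcvgZ 2 (rcvgB (hcvg_ipl (x - y) sx) (rcvg_cst (ip x (x - y)))).
have := rcvgD (rcvgD sx0 h) (rcvg_cst (ip (x - y) (x - y))).
apply: eq_rcvg.
  by move=> n /=; rewrite -ipBl -ip_sqrD addrA subrK.
by rewrite subrr mulr0 !add0r.
Qed.

Arguments hcvg_sqr {s x} y _.

(** Symmetry forces linearity, because the inner product separates vectors. *)
Definition self_adjoint_map (T : H -> H) := forall x y, ip (T x) y = ip x (T y).

Section SelfAdjointMap.
Variables (T : H -> H) (Tadj : self_adjoint_map T).

Lemma sadjD x y : T (x + y) = T x + T y.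
Proof. by apply: ip_inj => z; rewrite ipDl !Tadj ipDl. Qed.

Lemma sadjZ a x : T (a *: x) = a *: T x.
Proof. by apply: ip_inj => z; rewrite ipZl !Tadj ipZl. Qed.

Lemma sadj0 : T 0 = 0.
Proof. by rewrite -[X in T X](scale0r 0) sadjZ scale0r. Qed.

Lemma sadjB x y : T (x - y) = T x - T y.
Proof. by rewrite sadjD -scaleN1r sadjZ scaleN1r. Qed.

Lemma sadj_sum I (r : seq I) (p : pred I) (f : I -> H) :
  T (\sum_(i <- r | p i) f i) = \sum_(i <- r | p i) T (f i).
Proof.
elim/big_rec2: _ => [|i u v _ <-]; first exact: sadj0.
by rewrite sadjD.
Qed.

Hypothesis Tidem : forall x, T (T x) = T x.

(** A symmetric idempotent is an orthogonal projection. *)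
Lemma sadj_pythagoras x : ip x x = ip (T x) (T x) + ip (x - T x) (x - T x).
Proof.
rewrite ip_sqrB (_ : ip x (T x) = ip (T x) (T x)); first by ring.
by rewrite Tadj Tidem.
Qed.

Lemma sadj_contract x : ip (T x) (T x) <= ip x x.
Proof. by rewrite (sadj_pythagoras x) lerDl ip_ge0. Qed.

Lemma sadj_cocontract x : ip (x - T x) (x - T x) <= ip x x.
Proof. by rewrite [leRHS](sadj_pythagoras x) lerDr ip_ge0. Qed.

End SelfAdjointMap.

End HilbertTheory.
Arguments hcvg_ipl {R H s x} y _.
Arguments hcvg_ipr {R H s x} y _.
Arguments hcvg_sqr {R H s x} y _.

Section Projection.
Context (R : realType) (V H : hilbert R) (j : V -> H).
Hypothesis j_ip : forall x y, ip (j x) (j y) = ip x y.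

(** A map that preserves inner products is additive: the squared norm of the
    defect expands into inner products that cancel. *)
Lemma isometryD x y : j (x + y) = j x + j y.
Proof.
apply/eqP; rewrite -subr_eq0; apply/eqP/ip_eq0.
by rewrite !(ipBl, ipBr, ipDl, ipDr, j_ip); ring.
Qed.

Lemma isometryZ (a : R) x : j (a *: x) = a *: j x.
Proof.
apply/eqP; rewrite -subr_eq0; apply/eqP/ip_eq0.
by rewrite !(ipBl, ipBr, ipZl, ipZr, j_ip); ring.
Qed.

Lemma isometryB x y : j (x - y) = j x - j y.
Proof. by rewrite isometryD -scaleN1r isometryZ scaleN1r. Qed.

(** Projection theorem for the range of an isometry, which is complete because V
    is. A minimizing sequence for the distance to x is Cauchy by the parallelogram
    identity, and the first variation at its limit vanishes. *)
Lemma projection x : exists z : V, forall y, ip (x - j z) (j y) = 0.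
Proof.
pose f z := ip (j z - x) (j z - x); pose d := inf (range f).
have f0 z : 0 <= f z by exact: ip_ge0.
have lbf : has_lbound (range f) by exists 0 => _ [z _ <-].
have hi : has_inf (range f) by split=> //; exists (f 0); exists 0.
have df z : d <= f z by apply: ge_inf => //; exists z.
have /choice[s sP] n : exists z, f z < d + harmonic n.
  by have [_ [z _ <-] ?] := inf_adherent (harmonic_gt0 n) hi; exists z.
have par u v : ip (u - v) (u - v) <= 2 * (f u - d) + 2 * (f v - d).
  have := df (2^-1 *: (u + v)).
  have -> : ip (u - v) (u - v) = 2 * f u + 2 * f v - 4 * f (2^-1 *: (u + v)).
    rewrite /f isometryZ isometryD -j_ip isometryB.
    rewrite !(ipBl, ipBr, ipZl, ipZr, ipDl, ipDr) (ipC (j v) (j u)).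
    by rewrite (ipC x (j u)) (ipC x (j v)); field.
  by lra.
have [z sz] : exists z, hcvg s z.
  apply: ip_complete => e e0.
  have /cvgr0_norm_lt/(_ (e / 4)) := @cvg_harmonic R.
  case=> [|N _ hN]; first by lra.
  exists N => m n Nm Nn; apply: (le_lt_trans (par _ _)).
  have := hN m Nm; have := hN n Nn; rewrite !ger0_norm ?harmonic_ge0//.
  by have := sP m; have := sP n; lra.
have fz : f z <= d.
  have js : hcvg (j \o s) (j z).
    by rewrite /hcvg; under eq_fun do rewrite /= -isometryB j_ip.
  have h1 := hcvg_sqr x js.
  have h2 : (fun n => f (s n) - harmonic n) @ \oo --> f z - 0.
    by apply: rcvgB => //; exact: cvg_harmonic.
  rewrite -(subr0 (f z)); apply: (cvgr_to_le h2).
  by apply: nearW => n; rewrite lerBlDr ltW.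
exists z => y; set b := ip _ _; set c := ip y y.
have c0 : 0 <= c by exact: ip_ge0.
have key t : 2 * t * b <= t ^+ 2 * c.
  have := le_trans fz (df (z + t *: y)).
  rewrite /f isometryD isometryZ.
  rewrite (_ : j z + t *: j y - x = (j z - x) + t *: j y); last by rewrite addrAC.
  rewrite [in leRHS]ip_sqrD !ipZl !ipZr j_ip -/c.
  have -> : ip (j z - x) (j y) = - b by rewrite /b -ipNl opprB.
  by lra.
have c1 : 0 < c + 1 by lra.
have := key (b / (c + 1)).
rewrite -(ler_pM2r (exprn_gt0 2 c1)).
have -> : 2 * (b / (c + 1)) * b * (c + 1) ^+ 2 = 2 * b ^+ 2 * (c + 1).
  by field; lra.
have -> : (b / (c + 1)) ^+ 2 * c * (c + 1) ^+ 2 = b ^+ 2 * c by field; lra.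
move=> h; have b2 := sqr_ge0 b.
have : b ^+ 2 * (c + 2) <= 0 by lra.
rewrite pmulr_lle0; last by lra.
by move=> b2'; apply/eqP; rewrite -sqrf_eq0 eq_le b2' b2.
Qed.

End Projection.

(** * Moebius inversion on finite sets *)

Section Moebius.
Context (R : realType) (V : lmodType R) (I : choiceType).
Implicit Types (f : {fset I} -> V) (L M N : {fset I}) (k : I).

Definition moebius f M : V :=
  \sum_(L <- fpowerset M) (-1) ^+ (#|` M| - #|` L|) *: f L.

(** The subsets of k |` M come in pairs, without and with k; all inductions on
    finite sets below go through this splitting. *)
Lemma sum_fpowersetU1 f k M : k \notin M ->
  \sum_(L <- fpowerset (k |` M)%fset) f L =
  \sum_(L <- fpowerset M) (f L + f (k |` L)%fset).
Proof.
move=> kM; rewrite big_split /=.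
rewrite -(big_map (fun L => k |` L)%fset predT f) -big_cat /=.
apply: perm_big; apply: uniq_perm; first exact: fset_uniq.
  rewrite cat_uniq fset_uniq map_inj_in_uniq ?fset_uniq//=.
    rewrite andbT; apply/hasPn => _ /mapP[L _ ->].
    by apply/negP; rewrite fpowersetE => /fsubsetP/(_ k);
      rewrite fset1U1 (negbTE kM) => /(_ isT).
  move=> A B; rewrite !fpowersetE => AM BM AB.
  rewrite -(@fsetU1K _ k A) ?AB ?fsetU1K//.
    by apply: contra kM; apply: (fsubsetP BM).
  by apply: contra kM; apply: (fsubsetP AM).
move=> L; rewrite mem_cat !fpowersetE.
apply/idP/orP => [LkM|[LM|/mapP[L']]].
- have [kL|kL] := boolP (k \in L); last first.
    left; apply/fsubsetP => i iL.
    by have /(fsubsetP LkM) := iL; rewrite !inE => /predU1P[ik|//];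
      rewrite -ik iL in kL.
  right; apply/mapP; exists (L `\ k)%fset; last by rewrite fsetD1K.
  rewrite fpowersetE; apply/fsubsetP => i; rewrite !inE => /andP[ik].
  by move=> /(fsubsetP LkM); rewrite !inE (negbTE ik).
- exact: (fsubset_trans LM (fsubsetU1 _ _)).
- by rewrite fpowersetE => LM ->; exact: fsetUS.
Qed.

Lemma moebiusU1 f k M : k \notin M ->
  moebius f (k |` M)%fset = moebius (fun L => f (k |` L)%fset) M - moebius f M.
Proof.
move=> kM; rewrite /moebius sum_fpowersetU1// -sumrB !big_seq.
apply: eq_bigr => L; rewrite fpowersetE => LM.
have kL : k \notin L by apply: contra kM; apply: (fsubsetP LM).
rewrite !cardfsU1 kM kL/= !add1n subSS addrC subSn ?fsubset_leq_card//.
by rewrite exprS mulN1r scaleNr.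
Qed.

(** Induction on N for all f at once: adjoining k turns f into its translate
    fun L => f (k |` L), the other terms cancel by moebiusU1. *)
Lemma moebius_inversion f N : \sum_(M <- fpowerset N) moebius f M = f N.
Proof.
elim/fset1U_rect: N f => [|k N kN IH] f.
  by rewrite fpowerset0 big_seq_fset1 /moebius fpowerset0 big_seq_fset1 scale1r.
rewrite sum_fpowersetU1// -[RHS](IH (fun L => f (k |` L)%fset)) !big_seq.
apply: eq_bigr => M; rewrite fpowersetE => MN.
rewrite moebiusU1; first by rewrite addrC subrK.
by apply: contra kN; apply: (fsubsetP MN).
Qed.

Lemma moebius_eq0 f k M : k \in M -> (forall L, f (k |` L)%fset = f L) ->
  moebius f M = 0.
Proof.
move=> kM fk; rewrite -(fsetD1K kM) moebiusU1 ?inE ?eqxx//.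
by under [X in X - _]eq_bigr do rewrite fk; rewrite subrr.
Qed.

End Moebius.

(** * Hoeffding projections *)

Section HoeffdingProjections.
Context (R : realType) (H : hilbert R) (Q : set nat -> H -> H).
Hypothesis Qadj : forall A, self_adjoint_map (Q A).
Hypothesis QI : forall A B x, Q A (Q B x) = Q (A `&` B) x.
Hypothesis Qtotal : forall x, (forall n, Q `I_n x = 0) -> x = 0.
Implicit Types (x y z : H) (A B : set nat) (M N K : {fset nat}) (k n : nat).

(** The orthogonal projection onto the functions that depend on the variables
    with index in M and are centred in each of them. *)
Definition hoef M x := moebius (fun L : {fset nat} => Q [set` L] x) M.

Lemma QC A B x : Q A (Q B x) = Q B (Q A x).
Proof. by rewrite !QI setIC. Qed.

Lemma Qidem A x : Q A (Q A x) = Q A x.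
Proof. by rewrite QI setIid. Qed.

Lemma hoef_adj M : self_adjoint_map (hoef M).
Proof.
move=> x y; rewrite /hoef /moebius ip_suml ip_sumr.
by apply: eq_bigr => L _; rewrite ipZl ipZr Qadj.
Qed.

Lemma sum_hoef N x : \sum_(M <- fpowerset N) hoef M x = Q [set` N] x.
Proof. exact: (moebius_inversion (fun L : {fset nat} => Q [set` L] x)). Qed.

Lemma Q_hoefE A M x :
  Q A (hoef M x) = moebius (fun L : {fset nat} => Q (A `&` [set` L]) x) M.
Proof.
rewrite /hoef /moebius (sadj_sum (Qadj A)); apply: eq_bigr => L _.
by rewrite (sadjZ (Qadj A)) QI.
Qed.

Lemma Q_hoef A M x : [set` M] `<=` A -> Q A (hoef M x) = hoef M x.
Proof.
move=> MA; rewrite Q_hoefE /hoef /moebius !big_seq; apply: eq_bigr => L.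
rewrite fpowersetE => LM; congr (_ *: Q _ _); apply/setIidr => i /= iL.
by apply: MA => /=; apply: (fsubsetP LM).
Qed.

(** If A misses some k in M, then Q_A Q_L depends on L only up to k, and the
    alternating sum cancels in pairs. *)
Lemma Q_hoef0 A M k x : k \in M -> ~ A k -> Q A (hoef M x) = 0.
Proof.
move=> kM Ak; rewrite Q_hoefE; apply: (moebius_eq0 kM) => L; congr (Q _ x).
apply/seteqP; split => i [/= Ai] => [/fset1UP[ik|iL]|iL]; split=> //=.
  by rewrite ik in Ai.
exact: fset1Ur.
Qed.

(** If N does not contain M, then Q_hoef0 kills every term of hoef N. The case of a
    strict inclusion of M in N reduces to it, since the two maps commute. *)
Lemma hoef_hoefE N M x : hoef N (hoef M x) = if N == M then hoef M x else 0.
Proof.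
have sub N' M' : ~~ (M' `<=` N')%fset -> hoef N' (hoef M' x) = 0.
  move=> /fsubsetPn[k kM kN]; rewrite /hoef/= /moebius big_seq big1// => L.
  rewrite fpowersetE => LN; rewrite (Q_hoef0 _ kM) ?scaler0//=.
  by apply/negP; apply: contra kN; apply: (fsubsetP LN).
have [->|NM] := eqVneq N M.
  rewrite {1}/hoef /moebius.
  rewrite (big_fsetD1 M) ?fpowersetE//= subnn scale1r Q_hoef//.
  rewrite big_seq big1 ?addr0// => L; rewrite !inE fpowersetE => /andP[LM sLM].
  have /fsubsetPn[k kM kL] : ~~ (M `<=` L)%fset.
    by apply: contra LM => ML; rewrite eqEfsubset sLM.
  by rewrite (Q_hoef0 _ kM) ?scaler0//=; apply/negP.
have [MN|/sub//] := boolP (M `<=` N)%fset.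
have hc : hoef N (hoef M x) = hoef M (hoef N x).
  rewrite {1}/hoef /moebius; under eq_bigr do rewrite Q_hoefE.
  rewrite (_ : hoef N x = moebius (fun L => Q [set` L] x) N)//.
  rewrite [in RHS]/hoef [in RHS]/moebius.
  under [RHS]eq_bigr do rewrite Q_hoefE /moebius scaler_sumr.
  under [LHS]eq_bigr do rewrite /moebius scaler_sumr.
  rewrite exchange_big/=; apply: eq_bigr => L _; apply: eq_bigr => L' _.
  by rewrite !scalerA mulrC setIC.
rewrite hc sub//; apply: contra NM => NM.
by rewrite eqEfsubset NM MN.
Qed.

Definition iseg n : {fset nat} := [fset k in iota 0 n]%fset.

Lemma in_iseg n k : (k \in iseg n) = (k < n)%N.
Proof. by rewrite !inE mem_iota. Qed.

Lemma QnE n x : Q `I_n x = \sum_(M <- fpowerset (iseg n)) hoef M x.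
Proof.
rewrite sum_hoef; congr (Q _ x); apply/seteqP.
by split=> i /=; rewrite in_iseg.
Qed.

Lemma hoef_eq0 x : (forall M, hoef M x = 0) -> x = 0.
Proof. by move=> h; apply: Qtotal => n; rewrite QnE big1. Qed.

Lemma hoef_inj x y : (forall M, hoef M x = hoef M y) -> x = y.
Proof.
move=> h; apply/eqP; rewrite -subr_eq0; apply/eqP/hoef_eq0 => M.
by rewrite (sadjB (hoef_adj M)) h subrr.
Qed.

Lemma Qn_le m n x : (m <= n)%N -> Q `I_n (Q `I_m x) = Q `I_m x.
Proof.
move=> mn; rewrite QI; congr (Q _ x); apply/setIidr => i /= im.
exact: leq_trans im mn.
Qed.

(** The squared norms of Q_n x increase and are bounded, so that Q_n x is Cauchy
    by Pythagoras; the limit y satisfies Q_k (x - y) = 0 for all k, and totality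
    gives y = x. *)
Lemma Qn_cvg x : hcvg (fun n => Q `I_n x) x.
Proof.
pose a n := ip (Q `I_n x) (Q `I_n x).
have aE m n : (m <= n)%N ->
    ip (Q `I_n x - Q `I_m x) (Q `I_n x - Q `I_m x) = a n - a m.
  move=> mn; rewrite ip_sqrB; suff -> : ip (Q `I_n x) (Q `I_m x) = a m.
    by rewrite /a; ring.
  by rewrite Qadj Qn_le// /a Qadj Qidem.
have a_nd : nondecreasing_seq a.
  by move=> m n mn; rewrite -subr_ge0 -aE// ip_ge0.
have a_cvg : cvgn a.
  apply: nondecreasing_is_cvgn => //; exists (ip x x) => _ [n _ <-].
  by rewrite /a sadj_contract//; exact: Qidem.
have [y xy] : exists y, hcvg (fun n => Q `I_n x) y.
  apply: ip_complete => e e0.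
  have e2 : 0 < e / 2 by rewrite divr_gt0.
  have /cvgrPdist_lt/(_ _ e2)[N _ hN] : a @ \oo --> lim (a @ \oo) by [].
  exists N.
  have {}hN n : (N <= n)%N -> lim (a @ \oo) - e / 2 < a n <= lim (a @ \oo).
    move=> Nn; rewrite nondecreasing_cvgn_le// andbT.
    by have /ltr_normlW := hN n Nn; lra.
  move=> m n Nm Nn; wlog mn : m n Nm Nn / (m <= n)%N.
    move=> h; case/orP: (leq_total m n) => [|nm]; first exact: h.
    by rewrite -opprB ipNl ipNr opprK; exact: h.
  rewrite -opprB ipNl ipNr opprK aE//.
  by have /andP[] := hN m Nm; have /andP[] := hN n Nn; lra.
suff xE : x = y by rewrite -xE in xy.
apply/eqP; rewrite -subr_eq0; apply/eqP/Qtotal => k.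
rewrite (sadjB (Qadj _)); apply/eqP; rewrite subr_eq0; apply/eqP/ip_inj => z.
rewrite !Qadj; apply: rcvg_unique (hcvg_ipl (Q `I_k z) xy).
apply: cvg_near_cst; exists k => // n /= kn.
by rewrite Qadj Qn_le.
Qed.

Implicit Types (S : {fset {fset nat}}) (c : {fset nat} -> R).

(** Operators that are diagonal in the Hoeffding decomposition, with finite
    support: Q_n, its product with L, the partial sums that define the Hoeffding
    spaces and the approximate inverses of L - l are all of this form. *)
Definition hoef_weighted c S x :=
  \sum_(M <- S) c M *: hoef M x.

Lemma hoef_weightedE c S M x :
  hoef M (hoef_weighted c S x) = if M \in S then c M *: hoef M x else 0.
Proof.
rewrite (sadj_sum (hoef_adj M)).
under eq_bigr do rewrite (sadjZ (hoef_adj M)) hoef_hoefE.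
case: ifPn => MA.
  rewrite (big_fsetD1 M)//= eqxx big_seq big1 ?addr0// => N.
  by rewrite !inE eq_sym => /andP[/negbTE-> _]; rewrite scaler0.
rewrite big_seq big1// => N NA; case: eqP => [MN|_]; last by rewrite scaler0.
by rewrite MN NA in MA.
Qed.

Lemma hoef_weighted_adj c S : self_adjoint_map (hoef_weighted c S).
Proof.
move=> x y; rewrite ip_suml ip_sumr.
by apply: eq_bigr => M _; rewrite ipZl ipZr hoef_adj.
Qed.

Lemma hoef_weighted_comp c c' S S' x :
  hoef_weighted c S (hoef_weighted c' S' x) =
  hoef_weighted (fun M => c M * c' M) (S `&` S')%fset x.
Proof.
apply: hoef_inj => M; rewrite !hoef_weightedE inE.
by case: (M \in S); case: (M \in S') => //=; rewrite ?scaler0// scalerA.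
Qed.

Lemma hoef_weighted_sqr c S x :
  ip (hoef_weighted c S x) (hoef_weighted c S x) =
  \sum_(M <- S) c M ^+ 2 * ip (hoef M x) (hoef M x).
Proof.
rewrite hoef_weighted_adj hoef_weighted_comp fsetIid ip_sumr.
apply: eq_bigr => M _; rewrite ipZr -expr2; congr (_ * _).
by rewrite hoef_adj hoef_hoefE eqxx.
Qed.

(** Bessel's inequality with weights. *)
Lemma hoef_weighted_bound c C S x : (forall M, c M ^+ 2 <= C) -> 0 <= C ->
  ip (hoef_weighted c S x) (hoef_weighted c S x) <= C * ip x x.
Proof.
move=> cC C0; rewrite hoef_weighted_sqr.
apply: (@le_trans _ _ (C * \sum_(M <- S) ip (hoef M x) (hoef M x))).
  by rewrite mulr_sumr; apply: ler_sum => M _; rewrite ler_wpM2r ?ip_ge0.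
rewrite ler_wpM2l//.
have : ip (hoef_weighted (fun=> 1) S x) (hoef_weighted (fun=> 1) S x) <= ip x x.
  apply: sadj_contract; first exact: hoef_weighted_adj.
  by move=> y; rewrite hoef_weighted_comp fsetIid mul1r.
by rewrite hoef_weighted_sqr; under eq_bigr do rewrite expr1n mul1r.
Qed.

End HoeffdingProjections.

(** * The diagonal operator of the Hoeffding decomposition *)

Section AbstractOperators.
Context (R : realType) (H K : hilbert R).

Definition hclosure (B : H -> K -> Prop) : H -> K -> Prop := fun x u =>
  exists s : nat -> H * K,
    [/\ forall n, B (s n).1 (s n).2, hcvg (fst \o s) x & hcvg (snd \o s) u].

Definition hadjoint (B : H -> K -> Prop) : K -> H -> Prop := fun u x =>
  forall f g, B f g -> ip g u = ip f x.

End AbstractOperators.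

Section NumberOperator.
Context (R : realType) (H : hilbert R) (Q : set nat -> H -> H).
Hypothesis Qadj : forall A, self_adjoint_map (Q A).
Hypothesis QI : forall A B x, Q A (Q B x) = Q (A `&` B) x.
Hypothesis Qtotal : forall x, (forall n, Q `I_n x = 0) -> x = 0.
Implicit Types (x y z : H) (A B : set nat) (M N : {fset nat}) (k n : nat).
Local Notation hoef := (hoef Q).
Local Notation hoef_adj := (hoef_adj Qadj).

Definition diffop k x := x - Q [set j | j != k] x.

Lemma diffop_adj k : self_adjoint_map (diffop k).
Proof. by move=> x y; rewrite ipBl ipBr Qadj. Qed.

Lemma diffop_idem k x : diffop k (diffop k x) = diffop k x.
Proof.
by rewrite {1}/diffop (sadjB (Qadj _)) (Qidem QI) subrr subr0.
Qed.

Lemma diffop_Q k A x : diffop k (Q A x) = Q A (diffop k x).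
Proof. by rewrite /diffop (sadjB (Qadj _)) (QC QI). Qed.

Lemma diffop_Qn0 k n x : (n <= k)%N -> diffop k (Q `I_n x) = 0.
Proof.
move=> nk; rewrite /diffop QI (_ : _ `&` _ = `I_n) ?subrr//.
apply/setIidr => i /= ik; apply/eqP => e.
by move: ik; rewrite e ltnNge nk.
Qed.

Lemma diffop_hoef k M x : diffop k (hoef M x) = if k \in M then hoef M x else 0.
Proof.
rewrite /diffop; case: ifPn => kM.
  by rewrite (Q_hoef0 Qadj QI _ kM) ?subr0//= eqxx.
rewrite Q_hoef ?subrr// => i /= iM.
by apply: contraNneq kM => <-.
Qed.

Definition number_op n x :=
  hoef_weighted Q (fun M => #|` M|%:R) (fpowerset (iseg n)) x.

(** Each M is counted once for every k in M. *)
Lemma sum_diffop n x : \sum_(k < n) diffop k (Q `I_n x) = number_op n x.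
Proof.
under eq_bigr do rewrite QnE (sadj_sum (diffop_adj _)).
rewrite exchange_big /number_op /hoef_weighted/= !big_seq.
apply: eq_bigr => M; rewrite fpowersetE => Mn.
under eq_bigr do rewrite diffop_hoef.
rewrite -(big_mkord xpredT (fun k => if k \in M then hoef M x else 0)).
rewrite -big_mkcond -big_filter/= (perm_big (enum_fset M))/=.
  by rewrite big_const_seq count_predT iter_addr_0 scaler_nat.
apply: uniq_perm; rewrite ?filter_uniq ?iota_uniq ?fset_uniq// => i.
rewrite mem_filter mem_index_iota/= andbC.
by apply: andb_idl => /(fsubsetP Mn); rewrite in_iseg.
Qed.

(** This is the squared norm of D_k Q_n x, written with x on the right. *)
Lemma number_ip_ge0 n k x : 0 <= ip (diffop k (Q `I_n x)) x.
Proof.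
rewrite -[Q _ x](Qidem QI) diffop_Q Qadj -diffop_idem diffop_adj diffop_Q.
exact: ip_ge0.
Qed.

Lemma number_adj n : self_adjoint_map (number_op n).
Proof. exact: hoef_weighted_adj. Qed.

(** The graph of the diagonal operator with eigenvalue - #|M| on the range of
    hoef M, with its maximal domain. *)
Definition hoef_generator x y := forall M, hoef M y = - #|` M|%:R *: hoef M x.

Lemma number_generator n x y : hoef_generator x y -> number_op n x = - Q `I_n y.
Proof.
move=> xy; rewrite QnE -sumrN; apply: eq_bigr => M _.
by rewrite xy scaleNr opprK.
Qed.

Lemma Qn_weighted n x :
  Q `I_n x = hoef_weighted Q (fun=> 1) (fpowerset (iseg n)) x.
Proof. by rewrite QnE; apply: eq_bigr => M _; rewrite scale1r. Qed.

Lemma hoef_Qn n M x :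
  hoef M (Q `I_n x) = if M \in fpowerset (iseg n) then hoef M x else 0.
Proof. by rewrite Qn_weighted hoef_weightedE// scale1r. Qed.

Lemma generator_hoef M x : hoef_generator (hoef M x) (- #|` M|%:R *: hoef M x).
Proof.
move=> N; rewrite (sadjZ (hoef_adj N)) hoef_hoefE//.
by case: eqP => [->//|_]; rewrite !scaler0.
Qed.

Lemma generator_number n x : hoef_generator (Q `I_n x) (- number_op n x).
Proof.
move=> M; rewrite -scaleN1r (sadjZ (hoef_adj M)) hoef_weightedE//.
by rewrite hoef_Qn; case: ifP => _; rewrite ?scaler0// scalerA mulN1r.
Qed.

Lemma generator_dense x (e : R) : 0 < e ->
  exists z y, hoef_generator z y /\ ip (x - z) (x - z) < e.
Proof.
move=> e0; have /cvgr0_norm_lt/(_ _ e0)[N _ hN] := Qn_cvg Qadj QI Qtotal x.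
exists (Q `I_N x), (- number_op N x); split; first exact: generator_number.
rewrite -opprB ipNl ipNr opprK.
by have := hN N (leqnn N); rewrite ger0_norm ?ip_ge0.
Qed.

(** The graph is contained in its adjoint by passing to the limit in the identity
    for the truncations Q_n, on which the operator is bounded and symmetric.
    Conversely it suffices to test with hoef M z, which lies in the domain. *)
Lemma generator_adj : hoef_generator = hadjoint hoef_generator.
Proof.
apply/funext => x; apply/funext => y; apply/propext; split.
  move=> xy f g fg.
  have Qx := hcvg_ipr g (Qn_cvg Qadj QI Qtotal x).
  have Qy := hcvg_ipr f (Qn_cvg Qadj QI Qtotal y).
  apply: rcvg_unique Qx _; apply: eq_rcvg Qy => // n.
  have := number_generator n xy => /(congr1 -%R); rewrite opprK => <-.
  rewrite ipNr -number_adj (number_generator n fg).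
  by rewrite ipNl opprK Qadj.
move=> xy M; apply: ip_inj => z.
rewrite hoef_adj ipZl hoef_adj ipC -(xy _ _ (generator_hoef M z)).
by rewrite ipZl (ipC _ x).
Qed.

Lemma generator_ge0 x y : hoef_generator x y -> 0 <= ip x (- y).
Proof.
move=> xy; have := hcvg_ipr x (Qn_cvg Qadj QI Qtotal y).
move=> /(rcvgZ (-1)); rewrite mulN1r -ipNr => h.
apply: (cvgr_to_ge h); apply: nearW => n.
rewrite mulN1r -ipNr -(number_generator n xy) ip_sumr sumr_ge0// => M _.
rewrite ipZr mulr_ge0// -[hoef M x](_ : hoef M (hoef M x) = _).
  by rewrite -hoef_adj ip_ge0.
by rewrite hoef_hoefE ?eqxx.
Qed.

Definition hoef_eigen (l : R) x := hoef_generator x (l *: x).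

(** The relation (l + #|M|) hoef M x = 0. *)
Lemma hoef_eigenP l x : hoef_eigen l x <->
  forall M, l != - #|` M|%:R -> hoef M x = 0.
Proof.
split=> [lx M lM|h M]; last first.
  rewrite (sadjZ (hoef_adj M)).
  by have [->//|/h->] := eqVneq l (- #|` M|%:R); rewrite !scaler0.
have := lx M; rewrite (sadjZ (hoef_adj M)) => /eqP.
by rewrite -subr_eq0 -scalerBl scaler_eq0 subr_eq0 (negbTE lM) => /eqP.
Qed.

Lemma hoef_eigen0 l x : (forall p : nat, l != - p%:R) -> hoef_eigen l x -> x = 0.
Proof. by move=> lp /hoef_eigenP h; apply: (hoef_eq0 Qtotal) => M; apply: h. Qed.

(** The solution has components hoef M h / (- #|M| - l). The factors are
    bounded, since only finitely many integers are close to l, and where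
    - #|M| - l = 0 the vector hoef M h vanishes because it is an eigenvector. *)
Lemma generator_surj l : (forall x, hoef_eigen l x -> x = 0) ->
  forall h, exists x y, hoef_generator x y /\ h = y - l *: x.
Proof.
move=> linj h.
pose c M : R := (- #|` M|%:R - l)^-1.
have [C C0 cC] : exists2 C, 0 <= C & forall M, c M ^+ 2 <= C.
  have [k lk] : exists k : nat, `|l| + 1 < k%:R.
    by exists (Num.bound (`|l| + 1)); rewrite archi_boundP// addr_ge0.
  exists (1 + \sum_(m < k) ((- m%:R - l)^-1) ^+ 2).
    by rewrite addr_ge0// sumr_ge0// => m _; exact: sqr_ge0.
  move=> M; have [Mk|kM] := ltnP #|` M| k.
    rewrite (bigD1 (Ordinal Mk))//= addrCA lerDl addr_ge0// sumr_ge0// => m _.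
    exact: sqr_ge0.
  rewrite (@le_trans _ _ 1) ?lerDl ?sumr_ge0// => [|m _]; last exact: sqr_ge0.
  have {}lk : `|l| + 1 < #|` M|%:R by rewrite (lt_le_trans lk)// ler_nat.
  have /andP[l1 l2] : - `|l| <= l <= `|l| by rewrite -ler_norml.
  have cM : #|` M|%:R + l >= 1 by lra.
  rewrite /c -opprD invrN sqrrN exprVn invf_le1; last by rewrite exprn_gt0//; lra.
  by rewrite exprn_ege1.
pose s n := hoef_weighted Q c (fpowerset (iseg n)) h.
have sE m n : (m <= n)%N -> s n - s m =
    hoef_weighted Q c (fpowerset (iseg n)) (Q `I_n h - Q `I_m h).
  move=> mn; apply: hoef_inj => // M.
  rewrite (sadjB (hoef_adj M)) !hoef_weightedE//.
  rewrite (sadjB (hoef_adj M)) !hoef_Qn.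
  case: ifPn => [Mn|Mn]; first by case: ifP; rewrite !(scalerBr, scaler0, subr0).
  rewrite ifF ?subrr//; apply/negbTE; apply: contra Mn; rewrite !fpowersetE.
  move=> Mm; apply: (fsubset_trans Mm); apply/fsubsetP => i.
  by rewrite !in_iseg => im; exact: leq_trans im mn.
have [x sx] : exists x, hcvg s x.
  apply: ip_complete => e e0.
  have e4 : 0 < e / (4 * (C + 1)) by rewrite divr_gt0//; lra.
  have /cvgr0_norm_lt/(_ _ e4)[N _ hN] := Qn_cvg Qadj QI Qtotal h.
  exists N => m n Nm Nn; wlog mn : m n Nm Nn / (m <= n)%N.
    move=> w; case/orP: (leq_total m n) => [|nm]; first exact: w.
    by rewrite -opprB ipNl ipNr opprK; exact: w.
  rewrite -(opprB (s n)) ipNl ipNr opprK sE//.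
  apply: le_lt_trans (hoef_weighted_bound Qadj QI Qtotal _ _ cC C0) _.
  have := hN m Nm; have := hN n Nn; rewrite /= !ger0_norm ?ip_ge0//.
  set a := Q _ h; set b := Q _ h; move=> ah bh.
  have ab : ip (a - b) (a - b) <= 2 * ip (a - h) (a - h) + 2 * ip (b - h) (b - h).
    have := ip_ge0 ((a - h) + (b - h)).
    rewrite (_ : a - b = (a - h) - (b - h)); last by rewrite opprB addrA subrK.
    by rewrite (ip_sqrD (a - h)) (ip_sqrB (a - h)); lra.
  have C1 : 0 < C + 1 by lra.
  apply: (@le_lt_trans _ _ ((C + 1) * ip (a - b) (a - b))).
    by rewrite ler_wpM2r ?ip_ge0// lerDl.
  rewrite -ltr_pdivlMl//; apply: (le_lt_trans ab).
  rewrite (_ : _ * e = 2 * (e / (4 * (C + 1))) + 2 * (e / (4 * (C + 1)))).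
    by lra.
  by field; lra.
have xE M : hoef M x = c M *: hoef M h.
  apply: ip_inj => z; rewrite hoef_adj.
  apply: rcvg_unique (hcvg_ipl (hoef M z) sx) _.
  apply: cvg_near_cst; exists (\max_(k <- M) k.+1)%N => // n /= Mn.
  rewrite -hoef_adj hoef_weightedE// ifT// fpowersetE; apply/fsubsetP => k kM.
  by rewrite in_iseg (leq_trans _ Mn)//; exact: (@leq_bigmax_seq _ _ _ (fun k => k.+1)).
exists x, (h + l *: x); split; last by rewrite addrK.
move=> M; rewrite (sadjD (hoef_adj M)) (sadjZ (hoef_adj M)) xE.
have [lM|lM] := eqVneq l (- #|` M|%:R).
  suff -> : hoef M h = 0 by rewrite !scaler0 addr0.
  apply: linj => N; rewrite (sadjZ (hoef_adj N)) hoef_hoefE//.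
  by case: eqP => [->|_]; rewrite ?lM// !scaler0.
rewrite -[X in X + _]scale1r !scalerA -scalerDl; congr (_ *: _).
rewrite /c; field.
by rewrite -opprD oppr_eq0 addrC -[X in _ + X]opprK subr_eq0.
Qed.

(** Once S contains all subsets of {0, ..., N-1}, the remainder of an eigenvector is
    the image of x - Q_N x under the complement of a projection, hence at most as
    long. Conversely hoef M x with #|M| <> p is a component of every remainder. *)
Lemma hoef_eigen_net (p : nat) x : hoef_eigen (- p%:R) x <->
  (fun S : {fset {fset nat}} =>
    let z := x - \sum_(M <- S | #|` M| == p) hoef M x in ip z z)
  @ totally --> (0 : R).
Proof.
have SE (S : {fset {fset nat}}) y : \sum_(M <- S | #|` M| == p) hoef M y =
    hoef_weighted Q (fun M => (#|` M| == p)%:R) S y.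
  rewrite big_mkcond; apply: eq_bigr => M _.
  by case: ifP; rewrite ?scale1r ?scale0r.
split=> [/hoef_eigenP xp|xp]; last first.
  apply/hoef_eigenP => M; rewrite eqr_opp eqr_nat eq_sym => Mp.
  apply/ip_eq0/eqP; rewrite eq_le ip_ge0 andbT.
  apply/ler_addgt0Pr => e e0; rewrite add0r.
  have /cvgr0Pnorm_lt/(_ _ e0)/filter_ex[S] := xp.
  rewrite /= SE ger0_norm ?ip_ge0//; set z := _ - _ => /ltW; apply: le_trans.
  have -> : hoef M x = hoef M z.
    rewrite (sadjB (hoef_adj M)) hoef_weightedE// (negbTE Mp) scale0r.
    by case: ifP; rewrite subr0.
  apply: sadj_contract; first exact: hoef_adj.
  by move=> y; rewrite hoef_hoefE// eqxx.
apply/cvgr0Pnorm_lt => e e0.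
have /cvgr0_norm_lt/(_ _ e0)[N _ hN] := Qn_cvg Qadj QI Qtotal x.
exists (fpowerset (iseg N)) => // S /fsubsetP NS /=.
rewrite ger0_norm ?ip_ge0// SE.
have := hN N (leqnn N); rewrite /= ger0_norm ?ip_ge0//; apply: le_lt_trans.
rewrite -(opprB x) ipNl ipNr opprK; set W := hoef_weighted _ _ _.
have Wadj : self_adjoint_map W by exact: hoef_weighted_adj.
have -> : x - W x = (x - Q `I_N x) - W (x - Q `I_N x).
  rewrite (sadjB Wadj); suff -> : W (Q `I_N x) = Q `I_N x.
    by rewrite opprB addrA subrK.
  apply: hoef_inj => // M; rewrite hoef_weightedE// hoef_Qn.
  case: (boolP (M \in fpowerset _)) => [/NS ->|_]; last first.
    by rewrite scaler0; case: ifP.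
  case: eqP => [|/eqP Mp]; first by rewrite scale1r.
  by rewrite xp ?scaler0// eqr_opp eqr_nat eq_sym.
apply: sadj_cocontract => // y; rewrite /W hoef_weighted_comp// fsetIid.
by congr (hoef_weighted _ _ _ _); apply/funext => M; case: eqP; rewrite ?mulr1 ?mulr0.
Qed.

End NumberOperator.

(** * Closed gradient and its adjoint in a countable Hilbert sum *)

Lemma rcvg_sum (R : realType) (u : nat -> nat -> R) (l : nat -> R) (m : nat) :
  (forall k, u ^~ k @ \oo --> l k) ->
  (fun n => \sum_(k < m) u n k) @ \oo --> \sum_(k < m) l k.
Proof.
move=> ul; elim: m => [|m IH].
  by apply: eq_rcvg (rcvg_cst 0) => [n|]; rewrite big_ord0.
apply: eq_rcvg (rcvgD IH (ul m)) => [n|]; last by rewrite big_ord_recr.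
by rewrite /= big_ord_recr.
Qed.

(** The coordinates pr k embed K isometrically into the Hilbert sum of countably many
    copies of H. *)
Definition hilbert_sum (R : realType) (H K : hilbert R) (pr : nat -> K -> H) :=
  forall u v : K,
    (fun n => \sum_(k < n) ip (pr k u) (pr k v)) @ \oo --> ip u v.

Section HilbertSum.
Context (R : realType) (H K : hilbert R) (pr : nat -> K -> H).
Hypothesis pr_ip : hilbert_sum pr.
Arguments pr_ip : clear implicits.
Implicit Types (u v : K) (k n : nat).

Lemma pr_ip_le n u : \sum_(k < n) ip (pr k u) (pr k u) <= ip u u.
Proof.
have h := pr_ip u u; apply: (cvgr_to_ge h); exists n => // m /= nm.
rewrite -(subnKC nm) big_split_ord/= lerDl sumr_ge0// => k _.
exact: ip_ge0.
Qed.

Lemma pr_ip1_le k u : ip (pr k u) (pr k u) <= ip u u.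
Proof.
apply: le_trans (pr_ip_le k.+1 u).
by rewrite big_ord_recr/= lerDr sumr_ge0// => i _; exact: ip_ge0.
Qed.

(** The squared norms of the defects of additivity add up to that of 0. *)
Lemma prB k u v : pr k (u - v) = pr k u - pr k v.
Proof.
(* The right-hand side tends to the expansion of the squared norm of
   (u - v) - (u - v), which is 0. *)
have E n : \sum_(i < n) ip (pr i (u - v) - (pr i u - pr i v))
                           (pr i (u - v) - (pr i u - pr i v)) =
   \sum_(i < n) ip (pr i (u - v)) (pr i (u - v)) +
   \sum_(i < n) ip (pr i u) (pr i u) + \sum_(i < n) ip (pr i v) (pr i v)
   - 2 * \sum_(i < n) ip (pr i (u - v)) (pr i u)
   + 2 * \sum_(i < n) ip (pr i (u - v)) (pr i v)
   - 2 * \sum_(i < n) ip (pr i u) (pr i v).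
  rewrite !mulr_sumr -!(sumrB, big_split)/=; apply: eq_bigr => i _.
  by rewrite ip_sqrB ipBr (ip_sqrB (pr i u)); ring.
have h := rcvgB (rcvgD (rcvgB (rcvgD (rcvgD (pr_ip (u - v) (u - v)) (pr_ip u u))
  (pr_ip v v)) (rcvgZ 2 (pr_ip (u - v) u))) (rcvgZ 2 (pr_ip (u - v) v)))
  (rcvgZ 2 (pr_ip u v)).
have {}h := eq_rcvg (fun n => esym (E n)) erefl h.
apply/eqP; rewrite -subr_eq0; apply/eqP/ip_eq0/eqP.
rewrite eq_le ip_ge0 andbT.
have : \sum_(i < k.+1) ip (pr i (u - v) - (pr i u - pr i v))
                           (pr i (u - v) - (pr i u - pr i v)) <= 0.
  rewrite [leRHS](_ : 0 = ip (u - v) (u - v) + ip u u + ip v v -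
    2 * ip (u - v) u + 2 * ip (u - v) v - 2 * ip u v); last first.
    by rewrite ip_sqrB !ipBl (ipC v u); ring.
  apply: (cvgr_to_ge h); exists k.+1 => // m /= nm.
  rewrite -(subnKC nm) big_split_ord/= lerDl sumr_ge0// => i _.
  exact: ip_ge0.
by apply: le_trans; rewrite big_ord_recr/= lerDr sumr_ge0// => i _; exact: ip_ge0.
Qed.

Lemma pr_hcvg k s u : hcvg s u -> hcvg (pr k \o s) (pr k u).
Proof.
move=> su; apply: (@squeeze_cvgr _ _ _ _ (cst 0)
  (fun n => ip (s n - u) (s n - u))) => //; last exact: cvg_cst.
by apply: nearW => n; rewrite ip_ge0/= -prB pr_ip1_le.
Qed.

(** Dominated convergence. The tails are small uniformly in n, because they are
    dominated by those of u; finitely many coordinates remain. *)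
Lemma pr_dominated (v : nat -> K) u :
  (forall k, hcvg (pr k \o v) (pr k u)) ->
  (forall k n, ip (pr k (v n) - pr k u) (pr k (v n) - pr k u) <=
     ip (pr k u) (pr k u)) ->
  hcvg v u.
Proof.
move=> vu dom; apply/cvgr0Pnorm_lt => e e0.
have e2 : 0 < e / 3 by rewrite divr_gt0.
have /cvgrPdist_lt/(_ _ e2)[N _ hN] := pr_ip u u.
have : (fun n => \sum_(k < N) ip (pr k (v n) - pr k u) (pr k (v n) - pr k u))
    @ \oo --> (0 : R).
  have h := @rcvg_sum _ (fun n k =>
    ip (pr k (v n) - pr k u) (pr k (v n) - pr k u)) (fun=> 0) N vu.
  by apply: eq_rcvg h => //; rewrite big1.
move=> /cvgr0_norm_lt/(_ _ e2); apply: filterS => n hn.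
rewrite ger0_norm ?ip_ge0//.
suff : ip (v n - u) (v n - u) <= e / 3 + e / 3 by lra.
have h' := pr_ip (v n - u) (v n - u); apply: (cvgr_to_le h'); exists N => // m /= Nm.
under eq_bigr do rewrite prB.
rewrite -(subnKC Nm) big_split_ord/=; apply: lerD.
  by apply: ltW; apply: le_lt_trans hn; rewrite ler_norm.
apply: (@le_trans _ _ (\sum_(i < m - N) ip (pr (N + i)%N u) (pr (N + i)%N u))).
  by apply: ler_sum => i _; exact: dom.
have /= := hN N (leqnn N); have := pr_ip_le m u.
rewrite -(subnKC Nm) big_split_ord/= (subnKC Nm) => h /ltr_normlW; lra.
Qed.

End HilbertSum.

Section MalliavinGenerator.
Context (R : realType) (H K : hilbert R) (Q : set nat -> H -> H).
Variable pr : nat -> K -> H.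
Hypothesis Qadj : forall A, self_adjoint_map (Q A).
Hypothesis QI : forall A B x, Q A (Q B x) = Q (A `&` B) x.
Hypothesis Qtotal : forall x, (forall n, Q `I_n x = 0) -> x = 0.
Hypothesis pr_ip : hilbert_sum pr.
Arguments pr_ip : clear implicits.
Hypothesis pr_ex : forall (s : nat -> H) (C : R),
  (forall n, \sum_(k < n) ip (s k) (s k) <= C) ->
  exists u, forall k, pr k u = s k.

Definition gradient0 (x : H) (u : K) : Prop :=
  (exists n, Q `I_n x = x) /\ forall k, pr k u = diffop Q k x.

Definition gradient := hclosure gradient0.

(** Since D_k commutes with Q_n, the gradient of Q_n x has coordinates Q_n u_k. *)
Lemma gradient_approx x u : (forall k, pr k u = diffop Q k x) ->
  exists v : nat -> K,
    (forall n k, pr k (v n) = diffop Q k (Q `I_n x)) /\ hcvg v u.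
Proof.
move=> ux.
have E n k : diffop Q k (Q `I_n x) = Q `I_n (pr k u).
  by rewrite diffop_Q// ux.
have /choice[v vE] n : exists w, forall k, pr k w = diffop Q k (Q `I_n x).
  apply: (pr_ex (C := ip u u)) => m; apply: le_trans (pr_ip_le pr_ip m u).
  by apply: ler_sum => k _; rewrite E sadj_contract//; exact: Qidem.
exists v; split => //; apply: (pr_dominated pr_ip) => [k|k n].
  rewrite /hcvg; under eq_fun do rewrite /= vE E.
  exact: (Qn_cvg Qadj QI Qtotal).
rewrite vE E -opprB ipNl ipNr opprK.
by apply: sadj_cocontract => //; exact: Qidem.
Qed.

(** The maximal gradient is the closure of the gradient on smooth vectors: each
    coordinate of a closure relation passes to the limit, and conversely the
    truncations Q_n x approximate. *)
Lemma gradientP x u : gradient x u <-> forall k, pr k u = diffop Q k x.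
Proof.
split=> [[s [sD sx su]] k|ux].
  apply: ip_inj => z.
  apply: rcvg_unique (hcvg_ipl z (pr_hcvg pr_ip k su)) _.
  rewrite diffop_adj//; apply: eq_rcvg (hcvg_ipl (diffop Q k z) sx) => // n /=.
  by have [_ ->] := sD n; rewrite diffop_adj.
have [v [vE vu]] := gradient_approx ux.
exists (fun n => (Q `I_n x, v n)); split => //=; last exact: Qn_cvg.
by move=> n; split => //; exists n; rewrite Qidem.
Qed.

Lemma gradient_exists n x : Q `I_n x = x ->
  exists u, forall k, pr k u = diffop Q k x.
Proof.
move=> xn; pose a m := \sum_(k < m) ip (diffop Q k x) (diffop Q k x).
have a_nd m l : (m <= l)%N -> a m <= a l.
  move=> ml; rewrite /a -(subnKC ml) big_split_ord/= lerDl sumr_ge0// => k _.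
  exact: ip_ge0.
apply: (pr_ex (C := a n)) => m; rewrite -/(a m).
apply: (le_trans (a_nd _ _ (leq_maxr n m))).
rewrite /a -[maxn n m](subnKC (leq_maxl n m)) big_split_ord/= gerDl.
by rewrite sumr_le0// => k _; rewrite -xn diffop_Qn0 ?ip0l// leq_addr.
Qed.

(** As D_k is a projection, the D_k on the right can be moved to the left. *)
Lemma gradient_ip n f v x u : Q `I_n f = f ->
  (forall k, pr k v = diffop Q k f) -> (forall k, pr k u = diffop Q k x) ->
  ip v u = ip (number_op Q n f) x.
Proof.
move=> fn vf ux; apply: rcvg_unique (pr_ip v u) _.
apply: cvg_near_cst; exists n => // m /= nm.
rewrite -(subnKC nm) big_split_ord/= [X in _ + X]big1 => [|k _]; last first.
  by rewrite vf -fn diffop_Qn0 ?ip0l// leq_addr.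
rewrite addr0 -sum_diffop// ip_suml; apply: eq_bigr => k _.
by rewrite fn vf ux -(diffop_adj Qadj) diffop_idem.
Qed.

Definition generator x y := exists2 u, gradient x u & hadjoint gradient u (- y).

(** From left to right, the adjoint relation is tested with the gradient of
    hoef M z. From right to left, the sums over k < m of |D_k x|^2 are at most
    - <x, y>, by comparison with - <x, Q_n y> for large n; so x is in the domain
    of the gradient, and the adjoint relation follows from its truncations. *)
Lemma generatorE x y : generator x y <-> hoef_generator Q x y.
Proof.
split=> [[u /gradientP ux uy] M|xy].
  apply: ip_inj => z; rewrite hoef_adj//; set f := hoef Q M z.
  (* the least n such that M is a subset of {0, ..., n-1} *)
  pose n := (\max_(k <- M) k.+1)%N.
  have fn : Q `I_n f = f.
    apply: Q_hoef => // k kM /=.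
    exact: (@leq_bigmax_seq _ _ _ (fun k => k.+1)).
  have [v vf] := gradient_exists fn.
  have /uy : gradient f v by apply/gradientP.
  have -> : ip v u = ip (#|` M|%:R *: f) x.
    rewrite (gradient_ip fn vf ux) (number_generator n (generator_hoef Qadj QI M z)).
    by rewrite (sadjZ (Qadj _)) fn -scaleNr opprK.
  rewrite ipNr ipZl => /(congr1 -%R); rewrite opprK => yE.
  rewrite ipC -yE.
  by rewrite ipZl mulNr hoef_adj// (ipC x).
have Qy := hcvg_ipr x (Qn_cvg Qadj QI Qtotal y).
have [u ux] : exists u, forall k, pr k u = diffop Q k x.
  apply: (pr_ex (C := - ip x y)) => m.
  have h1 : (fun n => \sum_(k < m) ip (diffop Q k (Q `I_n x)) x) @ \oo -->
      \sum_(k < m) ip (diffop Q k x) (diffop Q k x).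
    apply: (@rcvg_sum _ (fun n k => ip (diffop Q k (Q `I_n x)) x)
      (fun k => ip (diffop Q k x) (diffop Q k x)) m) => k.
    rewrite (diffop_adj Qadj) (diffop_idem Qadj QI)//.
    apply: eq_rcvg (hcvg_ipl (diffop Q k x) (Qn_cvg Qadj QI Qtotal x)) => // n.
    by rewrite (diffop_adj Qadj).
  have h2 := rcvgB (rcvgZ (-1) Qy) h1.
  rewrite -subr_ge0 -(mulN1r (ip x y)); apply: (cvgr_to_ge h2).
  exists m => // n /= mn; rewrite mulN1r subr_ge0 -ipNr.
  rewrite -(number_generator n xy) -sum_diffop// ipC ip_suml.
  rewrite -(subnKC mn) big_split_ord/= (subnKC mn) lerDl sumr_ge0// => k _.
  exact: number_ip_ge0.
exists u; first exact/gradientP.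
move=> f w /gradientP fw.
have [v [vE vw]] := gradient_approx fw.
apply: rcvg_unique (hcvg_ipl u vw) _.
have := rcvgZ (-1) (hcvg_ipr f (Qn_cvg Qadj QI Qtotal y)).
apply: eq_rcvg; last by rewrite mulN1r ipNr.
move=> n /=; rewrite mulN1r -ipNr -(number_generator n xy).
rewrite (gradient_ip (Qidem QI `I_n f) (vE n) ux).
have -> : number_op Q n (Q `I_n f) = number_op Q n f.
  by rewrite -!sum_diffop// (Qidem QI).
by rewrite (number_adj Qadj).
Qed.

End MalliavinGenerator.

(** * Square-integrable functions and completeness of L2 *)

Section SquareIntegrable.
Context (R : realType) d (T : measurableType d) (mu : {measure set T -> \bar R}).
Implicit Types (f g h : T -> R).

Definition sq_integral f : \bar R := (\int[mu]_x ((f x) ^+ 2)%:E)%E.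

Lemma isq_ge0 f : (0 <= sq_integral f)%E.
Proof. by apply: integral_ge0 => x _; rewrite lee_fin sqr_ge0. Qed.

Lemma Lnorm_isq f : (Lnorm mu 2%:E (EFin \o f) `^ 2 = sq_integral f)%E.
Proof.
rewrite poweR_Lnorm; last by rewrite pnatr_eq0.
apply: eq_integral => x _ /=.
by rewrite powR_mulrn// real_normK// num_real.
Qed.

Lemma L2P f : L2 mu f <-> measurable_fun setT f /\ (sq_integral f < +oo)%E.
Proof.
rewrite /L2/= inE; split=> [/andP[]|[mf ff]].
  rewrite !inE/= => mf ff; split => //.
  by rewrite -Lnorm_isq poweR_lty.
apply/andP; split; rewrite !inE//= /finite_norm.
by rewrite (@lty_poweRy _ _ 2)// Lnorm_isq.
Qed.

Lemma L2_measurable f : L2 mu f -> measurable_fun setT f.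
Proof. by case/L2P. Qed.

Let p1 : (1 <= 2%:E :> \bar R)%E := lee1n 2.

Lemma L2_lin (a : R) f g : L2 mu f -> L2 mu g -> L2 mu (fun x => a * f x + g x).
Proof. by move=> lf lg; have [_] := @Lfun_submod_closed _ T R mu _ p1; apply. Qed.

Lemma L20 : L2 mu (cst 0).
Proof. by have [] := @Lfun_submod_closed _ T R mu _ p1. Qed.

Lemma L2D f g : L2 mu f -> L2 mu g -> L2 mu (fun x => f x + g x).
Proof.
move=> lf lg; rewrite (_ : (fun _ => _) = fun x => 1 * f x + g x); first exact: L2_lin.
by apply/funext => x; rewrite mul1r.
Qed.

Lemma L2Z (a : R) f : L2 mu f -> L2 mu (fun x => a * f x).
Proof.
move=> lf; rewrite (_ : (fun _ => _) = fun x => a * f x + cst 0 x).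
  exact: L2_lin lf L20.
by apply/funext => x; rewrite addr0.
Qed.

Lemma L2N f : L2 mu f -> L2 mu (fun x => - f x).
Proof.
move=> /(L2Z (-1)); congr (L2 mu _); apply/funext => x; exact: mulN1r.
Qed.

Lemma L2B f g : L2 mu f -> L2 mu g -> L2 mu (fun x => f x - g x).
Proof. by move=> lf /L2N; exact: L2D. Qed.

Lemma L2_sum (I : Type) (r : seq I) (F : I -> T -> R) :
  (forall i, L2 mu (F i)) -> L2 mu (fun x => \sum_(i <- r) F i x).
Proof.
move=> lF; elim: r => [|i r IH].
  by have := L20; congr (L2 mu _); apply/funext => x; rewrite big_nil.
rewrite (_ : (fun _ => _) = fun x => F i x + \sum_(j <- r) F j x); first exact: L2D.
by apply/funext => x; rewrite big_cons.
Qed.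

Lemma ae_eq_isq f g : measurable_fun setT f -> measurable_fun setT g ->
  f = g %[ae mu] -> sq_integral f = sq_integral g.
Proof.
move=> mf mg fg; apply: ge0_ae_eq_integral => //.
- by apply/measurable_EFinP; exact: measurable_funX.
- by apply/measurable_EFinP; exact: measurable_funX.
- by move=> x _; rewrite lee_fin sqr_ge0.
- by move=> x _; rewrite lee_fin sqr_ge0.
- by apply: filterS fg => x /= h Dx; rewrite h.
Qed.

Lemma L2_ae f g : measurable_fun setT g -> f = g %[ae mu] -> L2 mu f -> L2 mu g.
Proof.
move=> mg fg /L2P[mf lf]; apply/L2P; split => //.
by rewrite -(ae_eq_isq mf mg fg).
Qed.

Lemma isq_eq0 f : measurable_fun setT f -> sq_integral f = 0%E -> f = cst 0 %[ae mu].
Proof.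
move=> mf f0.
have : (\int[mu]_x `|((f x) ^+ 2)%:E| = 0)%E.
  by rewrite -[RHS]f0; apply: eq_integral => x _; rewrite gee0_abs// lee_fin sqr_ge0.
move=> /(ae_eq_integral_abs _ _ _).1 [//||N [mN N0 sN]].
  by apply/measurable_EFinP; exact: measurable_funX.
exists N; split => // x /= nf; apply: sN => /= h; apply: nf => _.
by have := h I => -[/eqP]; rewrite sqrf_eq0 => /eqP.
Qed.

(** A subsequence g with squared distances of consecutive terms below
    2^-(k+1) 4^-k converges a.e.: the series W of the squared increments with
    weights 4^k has a finite integral, and where W is finite the increments are
    dominated by a geometric series. Fatou's lemma turns the Cauchy property into
    convergence to the pointwise limit. *)
Lemma riesz_fischer (s : nat -> T -> R) : (forall n, L2 mu (s n)) ->
  (forall e : R, 0 < e -> exists N, forall m n, (N <= m)%N -> (N <= n)%N ->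
    (sq_integral (fun x => s m x - s n x)%R < e%:E)%E) ->
  exists2 f, L2 mu f & forall e : R, 0 < e -> exists N, forall n, (N <= n)%N ->
    (sq_integral (fun x => s n x - f x)%R <= e%:E)%E.
Proof.
move=> s2 sC.
have ms n : measurable_fun setT (s n) by exact: L2_measurable.
pose eps k : R := 1 / (2 ^ (k + 1))%:R / 4 ^+ k.
have eps0 k : 0 < eps k by rewrite !divr_gt0// ?exprn_gt0// ltr0n expn_gt0.
have /choice[N hN] k := sC _ (eps0 k).
(* The maximum makes phi j large enough for every k <= j. *)
pose phi k := (\max_(i < k.+1) N i)%N.
have Nphi k j : (k <= j)%N -> (N k <= phi j)%N.
  move=> kj.
  exact: (leq_bigmax (F := fun i : 'I_j.+1 => N i)
    (Ordinal (kj : (k < j.+1)%N))).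
pose g k := s (phi k).
have mg k : measurable_fun setT (g k) by exact: ms.
have gE k : (sq_integral (fun x => g k.+1 x - g k x)%R < (eps k)%:E)%E.
  by apply: hN; exact: Nphi.
pose w k x : \bar R := ((4 ^+ k) * (g k.+1 x - g k x) ^+ 2)%:E.
have mw k : measurable_fun setT (w k).
  apply/measurable_EFinP; apply: measurable_funM => //.
  by apply: measurable_funX; exact: measurable_funB.
have w0 k x : (0 <= w k x)%E by rewrite lee_fin mulr_ge0 ?sqr_ge0// exprn_ge0.
pose W x := (\sum_(k <oo) w k x)%E.
have mW : measurable_fun setT W by exact: ge0_emeasurable_sum.
have W0 x : (0 <= W x)%E by apply: nneseries_ge0 => *; exact: w0.
have iW : (\int[mu]_x W x < +oo)%E.
  rewrite integral_nneseries//.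
  apply: (@le_lt_trans _ _ (\sum_(k <oo) (1 / (2 ^ (k + 1))%:R : R)%:E)%E).
    apply: lee_nneseries => [k _ _|k _]; first by exact: integral_ge0.
    rewrite /w; under eq_integral do rewrite EFinM.
    rewrite ge0_integralZl//; last 2 first.
    - by apply/measurable_EFinP; apply: measurable_funX; exact: measurable_funB.
    - by move=> x _; rewrite lee_fin sqr_ge0.
    apply: le_trans (lee_wpmul2l _ (ltW (gE k))) _ => //.
    by rewrite -EFinM lee_fin /eps mulrC divfK// expf_neq0.
  rewrite (cvg_lim _ (@cvg_geometric_eseries_half R 1 0))//.
  exact: ltry.
have Wfin : {ae mu, forall x, W x \is a fin_num}.
  have : mu.-integrable setT W.
    apply/integrableP; split => //.
    by under eq_integral do rewrite gee0_abs//.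
  by move=> /(integrable_ae measurableT); apply: filterS => x /(_ I).
pose E := [set x | W x \is a fin_num].
have mE : measurable E.
  rewrite (_ : E = setT `&` (W @^-1` [set x | x \is a fin_num])); last first.
    by rewrite setTI.
  exact: emeasurable_fin_num.
pose h k x := g k x * \1_E x.
have mh k : measurable_fun setT (h k).
  by apply: measurable_funM => //; exact: measurable_indic.
have hg k : g k = h k %[ae mu].
  by apply: filterS Wfin => x xE _; rewrite /h indicE mem_set// mulr1.
have hcv x : cvgn (h ^~ x).
  have [xE|xE] := pselect (E x); last first.
    rewrite /h indicE memNset//; apply/cvg_ex; exists 0.
    by under eq_fun do rewrite mulr0; exact: cvg_cst.
  rewrite /h indicE mem_set//; under eq_fun do rewrite mulr1.
  pose b := fine (W x).
  have b0 : 0 <= b by rewrite fine_ge0.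
  have wb k : 4 ^+ k * (g k.+1 x - g k x) ^+ 2 <= b.
    rewrite -lee_fin fineK//.
    apply: le_trans (nneseries_lim_ge k.+1 _); last by move=> n _ _; exact: w0.
    by rewrite big_nat_recr//= leeDr//; apply: sume_ge0 => i _; exact: w0.
  have db k : `|g k.+1 x - g k x| <= geometric (1 + b) 2^-1 k.
    rewrite /geometric/=.
    have gb0 : 0 <= (1 + b) * 2^-1 ^+ k.
      by apply: mulr_ge0; [lra|rewrite exprn_ge0// invr_ge0].
    rewrite -(@ler_pXn2r _ 2) ?nnegrE//.
    rewrite exprMn real_normK ?num_real//.
    have := wb k; rewrite -ler_pdivlMl ?exprn_gt0//; move=> /le_trans; apply.
    rewrite mulrC -exprM mulnC exprM (_ : 2^-1 ^+ 2 = 4^-1); last by field.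
    rewrite exprVn ler_wpM2r ?invr_ge0 ?exprn_ge0//.
    by rewrite -subr_ge0 (_ : _ - _ = b ^+ 2 + b + 1); [nra|ring].
  have : cvgn (series (telescope (g ^~ x))).
    apply: normed_cvg; apply: (series_le_cvg _ _ db) => //.
      by move=> k; rewrite /geometric/= mulr_ge0 ?exprn_ge0 ?invr_ge0// addr_ge0.
    by apply: is_cvg_geometric_series; rewrite ger0_norm ?invr_ge0// invf_lt1// ltr1n.
  rewrite telescopeK => /cvg_ex[l gl]; apply/cvg_ex; exists (l + g 0%N x).
  by apply: eq_rcvg (rcvgD gl (rcvg_cst (g 0%N x))) => // n /=; rewrite subrK.
pose f x := lim (h ^~ x @ \oo).
have mf : measurable_fun setT f.
  by apply: (measurable_fun_cvg mh) => x _; exact: hcv.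
have fatou_s e n N0 :
    (forall k, (N0 <= k)%N ->
      (sq_integral (fun x => s n x - g k x)%R <= e%:E)%E) ->
    (sq_integral (fun x => s n x - f x)%R <= e%:E)%E.
  move=> hk.
  have -> : sq_integral (fun x => s n x - f x)%R =
      (\int[mu]_x limn_einf (fun k => ((s n x - h k x) ^+ 2)%:E))%E.
    apply: eq_integral => x _; apply/esym.
    have hl : (fun k => (s n x - h k x) ^+ 2) @ \oo --> (s n x - f x) ^+ 2.
      have hx : h ^~ x @ \oo --> f x by exact: hcv.
      have hs := rcvgB (rcvg_cst (s n x)) hx.
      exact: (@cvgM _ _ _ _ (fun k => s n x - h k x) (fun k => s n x - h k x)).
    have he : (fun k => ((s n x - h k x) ^+ 2)%:E) @ \oo --> ((s n x - f x) ^+ 2)%:E.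
      by apply: cvg_EFin hl; exact: nearW.
    by have [] := cvg_limn_einf_sup he.
  apply: (le_trans (fatou _ _ _ _)) => //.
  - move=> k; apply/measurable_EFinP; apply: measurable_funX.
    exact: measurable_funB.
  - by move=> k x _; rewrite lee_fin sqr_ge0.
  rewrite limn_einf_lim; apply: lime_le; first exact: is_cvg_einfs.
  apply: nearW => m.
  apply: (@le_trans _ _ (sq_integral (fun x => s n x - g (maxn m N0) x)%R)).
    rewrite (_ : sq_integral _ =
      sq_integral (fun x => s n x - h (maxn m N0) x)%R); last first.
      apply: ae_eq_isq; [exact: measurable_funB|exact: measurable_funB|].
      by apply: filterS (hg (maxn m N0)) => x /= hx xI; rewrite hx.
    by apply: ereal_inf_lbound; exists (maxn m N0) => //=; exact: leq_maxl.
  by apply: hk; exact: leq_maxr.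
have sfe (e : R) : 0 < e -> exists N0, forall n, (N0 <= n)%N ->
    (sq_integral (fun x => s n x - f x)%R <= e%:E)%E.
  move=> e0; have [N0 hN0] := sC e e0.
  have : eps @ \oo --> (0 : R).
    have := @cvg_geometric R (1 / 2) (8^-1).
    rewrite ger0_norm ?invr_ge0// invf_lt1// ltr1n => /(_ isT).
    apply: eq_rcvg => // k; rewrite /geometric/= /eps addn1 expnS natrM natrX.
    rewrite (_ : 8^-1 ^+ k = (2^-1) ^+ k * (4^-1) ^+ k); last first.
      by rewrite -exprMn; congr (_ ^+ k); field.
    by rewrite !exprVn; field; rewrite ?expf_neq0.
  move=> /cvgr0_norm_lt/(_ _ e0)[N1 _ hN1].
  exists (N N1) => n nN; apply: (fatou_s _ _ N1) => k N1k.
  apply: ltW; apply: (lt_trans (hN _ _ _ nN (Nphi _ _ N1k))).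
  by have := hN1 N1 (leqnn N1); rewrite /= ger0_norm ?lte_fin// ltW.
exists f => //.
have [N0 hN0] := sfe 1 ltr01.
have l2 : L2 mu (fun x => s N0 x - f x).
  apply/L2P; split; first exact: measurable_funB.
  by apply: le_lt_trans (hN0 N0 (leqnn _)) _; exact: ltry.
have := L2B (s2 N0) l2; congr (L2 mu _); apply/funext => x.
by rewrite opprB addrC subrK.
Qed.

End SquareIntegrable.

(** * The Hilbert space of classes of square-integrable functions *)

Section L2inner.
Context (R : realType) d (T : measurableType d) (mu : {measure set T -> \bar R}).
Implicit Types (f g h : T -> R).

Lemma L2_mul_integrable f g : L2 mu f -> L2 mu g ->
  mu.-integrable setT (EFin \o (fun x => f x * g x)).
Proof. by move=> lf lg; apply/Lfun1_integrable; exact: Lfun2_mul_Lfun1. Qed.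

Lemma ae_eq_L2inner f g f' g' : L2 mu f -> L2 mu g -> L2 mu f' -> L2 mu g' ->
  f = f' %[ae mu] -> g = g' %[ae mu] -> L2inner mu f g = L2inner mu f' g'.
Proof.
move=> lf lg lf' lg' ff' gg'; congr fine; apply: ae_eq_integral => //.
- exact: measurable_int (L2_mul_integrable lf lg).
- exact: measurable_int (L2_mul_integrable lf' lg').
- by apply: filterS2 ff' gg' => x /= h h' xI; rewrite h// h'.
Qed.

Lemma L2innerC f g : L2inner mu f g = L2inner mu g f.
Proof. by apply: eq_Rintegral => x _; rewrite mulrC. Qed.

Lemma L2innerDl f g h : L2 mu f -> L2 mu g -> L2 mu h ->
  L2inner mu (fun x => f x + g x) h = L2inner mu f h + L2inner mu g h.
Proof.
move=> lf lg lh; rewrite -RintegralD//; try exact: L2_mul_integrable.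
by apply: eq_Rintegral => x _; rewrite mulrDl.
Qed.

Lemma L2innerZl a f h : L2 mu f -> L2 mu h ->
  L2inner mu (fun x => a * f x) h = a * L2inner mu f h.
Proof.
move=> lf lh; rewrite -RintegralZl//; last exact: L2_mul_integrable.
by apply: eq_Rintegral => x _; rewrite mulrA.
Qed.

Lemma isq_L2inner f : L2 mu f -> sq_integral mu f = (L2inner mu f f)%:E.
Proof.
move=> lf; rewrite /L2inner /Rintegral fineK; first exact: eq_integral.
exact: (integrable_fin_num measurableT (L2_mul_integrable lf lf)).
Qed.

End L2inner.

Section L2Hilbert.
Local Open Scope quotient_scope.
Context (R : realType) d (T : measurableType d) (mu : {measure set T -> \bar R}).

(** A copy of the space L2 as a type with choice, from which the quotient by a.e.
    equality is taken. *)
Definition L2fun := {f : T -> R | `[< L2 mu f >]}.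
HB.instance Definition _ := gen_eqMixin L2fun.
HB.instance Definition _ := gen_choiceMixin L2fun.

Lemma L2fun_L2 (f : L2fun) : L2 mu (sval f).
Proof. by apply/asboolP; exact: (svalP f). Qed.

Definition L2eq (f g : L2fun) := `[< sval f = sval g %[ae mu] >].

Let L2eq_refl : reflexive L2eq.
Proof. by move=> f; apply/asboolP; exact: ae_eq_refl. Qed.

Let L2eq_sym : symmetric L2eq.
Proof.
by move=> f g; apply/idP/idP => /asboolP h; apply/asboolP/ae_eq_sym.
Qed.

Let L2eq_trans : transitive L2eq.
Proof.
by move=> f g h /asboolP gf /asboolP fh; apply/asboolP/(ae_eq_trans gf fh).
Qed.

Canonical L2eq_equiv := EquivRel L2eq L2eq_refl L2eq_sym L2eq_trans.

Definition L2q : Type := {eq_quot L2eq}.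
HB.instance Definition _ := Choice.on L2q.
HB.instance Definition _ := EqQuotient.on L2q.

Let L2fun0 : L2fun := exist _ (cst 0) (asboolT (L20 mu)).

(** The class of f, and that of 0 if f is not square-integrable: a total function
    spares proofs of membership in the terms. *)
Definition L2class (f : T -> R) : L2q := \pi_L2q (insubd L2fun0 f).

Definition L2rep (x : L2q) : T -> R := sval (repr x).

Lemma L2rep_L2 x : L2 mu (L2rep x).
Proof. exact: L2fun_L2. Qed.

Lemma L2repK x : L2class (L2rep x) = x.
Proof. by rewrite /L2class /L2rep valKd reprK. Qed.

Lemma L2class_eq f g : L2 mu f -> L2 mu g ->
  L2class f = L2class g <-> f = g %[ae mu].
Proof.
move=> /asboolP lf /asboolP lg.
have lE h : `[< L2 mu h >] -> sval (insubd L2fun0 h) = h.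
  by move=> hh; exact: (@insubdK _ _ L2fun L2fun0 h hh).
split=> [/eqP|fg]; last first.
  by apply/eqP; rewrite eqmodE; apply/asboolP; rewrite !lE.
by rewrite eqmodE => /asboolP; rewrite !lE.
Qed.

Lemma L2rep_class f : L2 mu f -> L2rep (L2class f) = f %[ae mu].
Proof. by move=> lf; apply/L2class_eq => //; [exact: L2rep_L2|exact: L2repK]. Qed.

Definition L2q_add (x y : L2q) := L2class (fun t => L2rep x t + L2rep y t).
Definition L2q_scale (a : R) (x : L2q) := L2class (fun t => a * L2rep x t).
Definition L2q_opp (x : L2q) := L2class (fun t => - L2rep x t).

Lemma L2class_add f g : L2 mu f -> L2 mu g ->
  L2q_add (L2class f) (L2class g) = L2class (fun t => f t + g t).
Proof.
move=> lf lg; apply/L2class_eq; [exact/L2D/L2rep_L2/L2rep_L2|exact: L2D|].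
by apply: filterS2 (L2rep_class lf) (L2rep_class lg) => t /= h h' tI; rewrite h ?h'.
Qed.

Lemma L2class_scale a f : L2 mu f ->
  L2q_scale a (L2class f) = L2class (fun t => a * f t).
Proof.
move=> lf; apply/L2class_eq; [exact/L2Z/L2rep_L2|exact: L2Z|].
by apply: filterS (L2rep_class lf) => t /= h tI; rewrite h.
Qed.

Lemma L2class_opp f : L2 mu f -> L2q_opp (L2class f) = L2class (fun t => - f t).
Proof.
move=> lf; apply/L2class_eq; [exact/L2N/L2rep_L2|exact: L2N|].
by apply: filterS (L2rep_class lf) => t /= h tI; rewrite h.
Qed.

Lemma L2q_ind (P : L2q -> Prop) :
  (forall f, L2 mu f -> P (L2class f)) -> forall x, P x.
Proof. by move=> h x; rewrite -(L2repK x); exact/h/L2rep_L2. Qed.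

Let addA : associative L2q_add.
Proof.
elim/L2q_ind => f lf; elim/L2q_ind => g lg; elim/L2q_ind => h lh.
rewrite !L2class_add//; try exact: L2D.
by congr L2class; apply/funext => t; rewrite addrA.
Qed.

Let addC : commutative L2q_add.
Proof.
elim/L2q_ind => f lf; elim/L2q_ind => g lg; rewrite !L2class_add//.
by congr L2class; apply/funext => t; rewrite addrC.
Qed.

Let add0 : left_id (L2class (cst 0)) L2q_add.
Proof.
elim/L2q_ind => f lf; rewrite L2class_add//; last exact: L20.
by congr L2class; apply/funext => t; rewrite add0r.
Qed.

Let addN : left_inverse (L2class (cst 0)) L2q_opp L2q_add.
Proof.
elim/L2q_ind => f lf; rewrite L2class_opp// L2class_add//; last exact: L2N.
by congr L2class; apply/funext => t; rewrite addNr.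
Qed.

HB.instance Definition _ := GRing.isZmodule.Build L2q addA addC add0 addN.

Let scaleA a b x : L2q_scale a (L2q_scale b x) = L2q_scale (a * b) x.
Proof.
elim/L2q_ind: x => f lf; rewrite !L2class_scale//; last exact: L2Z.
by congr L2class; apply/funext => t; rewrite mulrA.
Qed.

Let scale1 : left_id 1 L2q_scale.
Proof.
elim/L2q_ind => f lf; rewrite L2class_scale//.
by congr L2class; apply/funext => t; rewrite mul1r.
Qed.

Let scaleDr : right_distributive L2q_scale +%R.
Proof.
move=> a; elim/L2q_ind => f lf; elim/L2q_ind => g lg.
rewrite /GRing.add/= !(L2class_scale, L2class_add)//; try exact: L2Z; try exact: L2D.
by congr L2class; apply/funext => t; rewrite mulrDr.
Qed.

Let scaleDl x : {morph L2q_scale^~ x : a b / a + b >-> a + b}.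
Proof.
move=> a b; elim/L2q_ind: x => f lf.
rewrite [RHS]/GRing.add/= !(L2class_scale, L2class_add)//; try exact: L2Z.
by congr L2class; apply/funext => t; rewrite mulrDl.
Qed.

HB.instance Definition _ :=
  GRing.Zmodule_isLmodule.Build R L2q scaleA scale1 scaleDr scaleDl.

Lemma L2classD f g : L2 mu f -> L2 mu g ->
  L2class (fun t => f t + g t) = L2class f + L2class g.
Proof. by move=> lf lg; rewrite -L2class_add. Qed.

Lemma L2classZ a f : L2 mu f -> L2class (fun t => a * f t) = a *: L2class f.
Proof. by move=> lf; rewrite -L2class_scale. Qed.

Lemma L2classN f : L2 mu f -> L2class (fun t => - f t) = - L2class f.
Proof. by move=> lf; rewrite -L2class_opp. Qed.

Lemma L2classB f g : L2 mu f -> L2 mu g ->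
  L2class (fun t => f t - g t) = L2class f - L2class g.
Proof. by move=> lf lg; rewrite L2classD ?L2classN//; exact: L2N. Qed.

Lemma L2class0 : L2class (cst 0) = 0.
Proof. by []. Qed.

Definition L2ip (x y : L2q) : R := L2inner mu (L2rep x) (L2rep y).

Lemma L2ip_class f g : L2 mu f -> L2 mu g ->
  L2ip (L2class f) (L2class g) = L2inner mu f g.
Proof.
by move=> lf lg; apply: ae_eq_L2inner => //; (exact: L2rep_L2 || exact: L2rep_class).
Qed.

Let ipC x y : L2ip x y = L2ip y x.
Proof. exact: L2innerC. Qed.

Let ipDl x y z : L2ip (x + y) z = L2ip x z + L2ip y z.
Proof.
elim/L2q_ind: x => f lf; elim/L2q_ind: y => g lg; elim/L2q_ind: z => h lh.
by rewrite -L2classD// !L2ip_class//; [exact: L2innerDl|exact: L2D].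
Qed.

Let ipZl a x y : L2ip (a *: x) y = a * L2ip x y.
Proof.
elim/L2q_ind: x => f lf; elim/L2q_ind: y => g lg.
by rewrite -L2classZ// !L2ip_class//; [exact: L2innerZl|exact: L2Z].
Qed.

Let ip_ge0 x : 0 <= L2ip x x.
Proof. by apply: Rintegral_ge0 => t _; rewrite -expr2 sqr_ge0. Qed.

Let ip_eq0 x : L2ip x x = 0 -> x = 0.
Proof.
elim/L2q_ind: x => f lf; rewrite L2ip_class// => f0.
apply/L2class_eq => //; first exact: L20.
by apply: isq_eq0; [exact: L2_measurable lf|rewrite isq_L2inner// f0].
Qed.

Let ip_complete (s : nat -> L2q) :
  (forall e, 0 < e -> exists N, forall m n, (N <= m)%N -> (N <= n)%N ->
    L2ip (s m - s n) (s m - s n) < e) ->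
  exists x, (fun n => L2ip (s n - x) (s n - x)) @ \oo --> (0 : R).
Proof.
move=> sC; have rl n := L2rep_L2 (s n).
have [|f lf sf] := riesz_fischer rl.
  move=> e e0; have [N hN] := sC e e0; exists N => m n Nm Nn.
  rewrite isq_L2inner; last exact: L2B.
  rewrite lte_fin -L2ip_class; try exact: L2B.
  by rewrite L2classB// !L2repK; exact: hN.
exists (L2class f); apply/cvgr0Pnorm_le => e e0.
have [N hN] := sf e e0; exists N => // n /= Nn.
rewrite ger0_norm// -[s n]L2repK -L2classB// L2ip_class; try exact: L2B.
by rewrite -lee_fin -isq_L2inner; [exact: hN|exact: L2B].
Qed.

Definition L2hilbert : hilbert R :=
  Hilbert ipC ipDl ipZl ip_ge0 ip_eq0 ip_complete.

End L2Hilbert.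

(** * Operators on functions and operators on classes *)

Section L2distance.
Context (R : realType) d (T : measurableType d) (mu : {measure set T -> \bar R}).
Local Notation H := (L2hilbert mu).
Local Notation cl := (@L2class R d T mu : (T -> R) -> H).
Implicit Types (f g h : T -> R).

Lemma ip_class f g : L2 mu f -> L2 mu g -> ip (cl f) (cl g) = L2inner mu f g.
Proof. exact: L2ip_class. Qed.

(** The L2 distance takes values in the extended reals; for square-integrable
    functions it is the norm of the difference of the classes. *)
Lemma L2distE f g : L2 mu f -> L2 mu g ->
  L2dist mu f g = (Num.sqrt (ip (cl f - cl g) (cl f - cl g)))%:E.
Proof.
move=> lf lg; have lfg := L2B lf lg.
rewrite -[cl f - cl g](L2classB lf lg) ip_class//.
have : (L2dist mu f g < +oo)%E.
  by move: lfg; rewrite /L2/= inE => /andP[_]; rewrite inE.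
have : (0 <= L2dist mu f g)%E by exact: Lnorm_ge0.
have := Lnorm_isq mu (fun x => f x - g x); rewrite isq_L2inner//.
rewrite -[Lnorm _ _ _]/(L2dist mu f g); case: (L2dist mu f g) => //= r.
rewrite lee_fin => -[<-] r0 _.
by rewrite powR_mulrn// sqrtr_sqr ger0_norm.
Qed.

Lemma L2dist_cvg0 (I : Type) (F : set_system I) (FF : Filter F)
    (s : I -> T -> R) f : (forall i, L2 mu (s i)) -> L2 mu f ->
  ((fun i => L2dist mu (s i) f) @ F --> 0%E) <->
  ((fun i => ip (cl (s i) - cl f) (cl (s i) - cl f)) @ F --> (0 : R)).
Proof.
move=> ls lf; under eq_fun do rewrite L2distE//.
set a := fun i => ip _ _.
rewrite -[X in X <-> _]/((EFin \o (fun i => Num.sqrt (a i))) @ F --> 0%:E).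
split=> [/fine_cvgP[_]|a0].
  rewrite -[_ \o _]/(fun i => Num.sqrt (a i)) => sa.
  have aE i : a i = Num.sqrt (a i) * Num.sqrt (a i).
    by rewrite -expr2 sqr_sqrtr// ip_ge0.
  have -> : a = (fun i => Num.sqrt (a i) * Num.sqrt (a i)) by exact/funext.
  have h := @cvgM _ _ _ _ (fun i => Num.sqrt (a i)) (fun i => Num.sqrt (a i)) _ _ sa sa.
  by rewrite mulr0 in h; exact: h.
apply: cvg_EFin; first exact: nearW.
rewrite -[_ \o _]/(fun i => Num.sqrt (a i)).
have sc : Num.sqrt x @[x --> (0 : R)] --> Num.sqrt (0 : R) by exact: sqrt_continuous.
have h := @cvg_comp _ _ _ a Num.sqrt _ _ _ a0 sc.
by rewrite sqrtr0 in h.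
Qed.

End L2distance.

Section Lift.
Context (R : realType).
Context d (T : measurableType d) (mu : {measure set T -> \bar R}).
Context d' (U : measurableType d') (nu : {measure set U -> \bar R}).
Local Notation H := (L2hilbert mu).
Local Notation K := (L2hilbert nu).
Local Notation clH := (@L2class R d T mu : (T -> R) -> H).
Local Notation clK := (@L2class R d' U nu : (U -> R) -> K).

(** The relation between functions induced by a relation between classes. Every
    operator below is of this form, which reduces it to its abstract version. *)
Definition lift_graph (B : H -> K -> Prop) : graph R T U :=
  [set fg | [/\ L2 mu fg.1, L2 nu fg.2 & B (clH fg.1) (clK fg.2)]].

Lemma lift_graph_rep B x u : B x u -> lift_graph B (L2rep x, L2rep u).
Proof. by split; rewrite /= ?L2repK//; exact: L2rep_L2. Qed.

Lemma lift_graph_r B f u : L2 mu f -> B (clH f) u -> lift_graph B (f, L2rep u).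
Proof. by move=> lf fu; split; rewrite /= ?L2repK//; exact: L2rep_L2. Qed.

Lemma lift_graph_l B x g : L2 nu g -> B x (clK g) -> lift_graph B (L2rep x, g).
Proof. by move=> lg xg; split; rewrite /= ?L2repK//; exact: L2rep_L2. Qed.

Lemma closure_lift B : closure_op mu nu (lift_graph B) = lift_graph (hclosure B).
Proof.
apply/seteqP; split=> -[f g]; rewrite /closure_op/lift_graph/=.
  move=> [lf lg [s [sB s1 s2]]]; split => //.
  exists (fun n => (clH (s n).1, clK (s n).2)); split => /=.
  - by move=> n; have [] := sB n.
  - by apply/L2dist_cvg0 => // n; have [] := sB n.
  - by apply/L2dist_cvg0 => // n; have [] := sB n.
move=> [lf lg [s [sB s1 s2]]]; split => //.
exists (fun n => (L2rep (s n).1, L2rep (s n).2)); split => /=.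
- by move=> n; exact: lift_graph_rep.
- apply/L2dist_cvg0 => // [n|]; first exact: L2rep_L2.
  by under eq_fun do rewrite L2repK.
- apply/L2dist_cvg0 => // [n|]; first exact: L2rep_L2.
  by under eq_fun do rewrite L2repK.
Qed.

Lemma densely_defined_lift B :
  (forall x (e : R), 0 < e -> exists z u, B z u /\ ip (x - z) (x - z) < e) ->
  densely_defined mu (lift_graph B).
Proof.
move=> dB f lf e e0; have [z [u [zu ze]]] := dB (clH f) _ (exprn_gt0 2 e0).
exists (L2rep z); first by exists (L2rep u); exact: lift_graph_rep.
rewrite L2distE//; last exact: L2rep_L2.
rewrite lte_fin L2repK -(ltr_pXn2r (n := 2)) ?nnegrE ?sqrtr_ge0 ?ltW//.
by rewrite sqr_sqrtr// ip_ge0.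
Qed.

End Lift.

Section LiftAdjoint.
Context (R : realType).
Context d (T : measurableType d) (mu : {measure set T -> \bar R}).
Context d' (U : measurableType d') (nu : {measure set U -> \bar R}).

Lemma adjoint_lift (B : L2hilbert mu -> L2hilbert nu -> Prop) :
  adjoint mu nu (lift_graph B) = lift_graph (hadjoint B).
Proof.
apply/seteqP; split=> -[h k]; rewrite /adjoint/lift_graph/=.
  move=> [lh lk hk]; split => // f g /lift_graph_rep /hk.
  by rewrite -!ip_class ?L2repK//; exact: L2rep_L2.
move=> [lh lk hk]; split => // f g [/= lf lg /hk].
by rewrite !ip_class.
Qed.

End LiftAdjoint.

Section LiftSpectrum.
Context (R : realType) d (T : measurableType d) (mu : {measure set T -> \bar R}).
Local Notation H := (L2hilbert mu).
Local Notation cl := (@L2class R d T mu : (T -> R) -> H).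
Implicit Types (A : H -> H -> Prop).

Lemma shift_lift A l :
  shift_op mu (lift_graph A) l =
  lift_graph (fun x z => exists2 y, A x y & z = y - l *: x).
Proof.
apply/seteqP; split=> -[f h]; rewrite /shift_op/=.
  move=> [lh [g [/= lf lg fg] hE]]; split => //; exists (cl g) => //.
  rewrite -[l *: _](L2classZ _ lf) -[RHS](L2classB lg (L2Z l lf)).
  by apply/L2class_eq => //; exact/L2B/L2Z.
move=> [/= lf lh [y fy hE]]; split => //; exists (L2rep y).
  by split => //=; [exact: L2rep_L2|rewrite L2repK].
apply/(L2class_eq lh); first exact: L2B (L2rep_L2 y) (L2Z l lf).
by rewrite L2classB ?L2classZ ?L2repK//; [exact: L2rep_L2|exact: L2Z].
Qed.

Lemma injective_lift A : injective_op mu (lift_graph A) <->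
  forall x y z, A x z -> A y z -> x = y.
Proof.
split=> [iA x y z xz yz|iA f g h [/= lf lh fh] [/= lg _ gh]].
  rewrite -[x]L2repK -[y]L2repK; apply/L2class_eq; try exact: L2rep_L2.
  exact: iA (lift_graph_rep xz) (lift_graph_rep yz).
by apply/L2class_eq => //; exact: iA fh gh.
Qed.

Lemma surjective_lift A : surjective_op mu (lift_graph A) <->
  forall z, exists x, A x z.
Proof.
split=> [sA z|sA h lh].
  have [f [/= lf _ fz]] := sA _ (L2rep_L2 z).
  by exists (cl f); rewrite -[z]L2repK.
have [x xz] := sA (cl h); exists (L2rep x).
by split => //=; [exact: L2rep_L2|rewrite L2repK].
Qed.

End LiftSpectrum.

(** * Conditional expectation as an orthogonal projection *)

Section SubSigmaAlgebra.
Context (R : realType) d (T : measurableType d) (mu : {measure set T -> \bar R}).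
Hypothesis mu_fin : (mu setT < +oo)%E.
Variable G : set (set T).
Hypothesis sG : <<s G >> `<=` measurable.

Let TG := g_sigma_algebraType G.
Let toG : T -> TG := idfun.

Let measurable_toG : measurable_fun setT toG.
Proof. by move=> _ B mB; rewrite setTI; exact: sG. Qed.

Let nu : {measure set TG -> \bar R} :=
  measure_function_pushforward__canonical__measure_function_Measure
    mu measurable_toG.

(** Measurability for the smaller sigma-algebra is measurability on the space TG with
    that sigma-algebra, on which nu is the restriction of mu. *)
Lemma measurable_wrtP (f : T -> R) :
  measurable_wrt <<s G >> f <-> measurable_fun (setT : set TG) (f : TG -> R).
Proof.
split=> [mf _ B mB|mf B mB]; first by rewrite setTI; exact: mf.
by have := mf (@measurableT _ TG) B mB; rewrite setTI.
Qed.

Lemma measurable_wrt_measurable (f : T -> R) :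
  measurable_wrt <<s G >> f -> measurable_fun setT f.
Proof. by move=> mf _ B mB; rewrite setTI; exact: (sG (mf B mB)). Qed.

Lemma L2_indic A : measurable A -> L2 mu (\1_A : T -> R).
Proof.
move=> mA; apply/L2P; split; first exact: measurable_indic.
rewrite /sq_integral; under eq_integral => x _.
  rewrite (_ : \1_A x ^+ 2 = \1_A x); first over.
  by rewrite indicE; case: (_ \in _); rewrite ?expr1n ?expr0n.
rewrite integral_indic// setIT; apply: le_lt_trans mu_fin.
by apply: le_measure; rewrite ?inE.
Qed.

Let isq_nu (f : T -> R) : measurable_wrt <<s G >> f ->
  sq_integral nu (f : TG -> R) = sq_integral mu f.
Proof.
move=> /measurable_wrtP mf; rewrite /sq_integral ge0_integral_pushforward//.
  by apply/measurable_EFinP; exact: measurable_funX.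
by move=> x _; rewrite lee_fin sqr_ge0.
Qed.

Let L2_nu (f : T -> R) :
  L2 nu (f : TG -> R) <-> L2 mu f /\ measurable_wrt <<s G >> f.
Proof.
split=> [/L2P[mf lf]|[/L2P[_ lf] mf]].
  have wf : measurable_wrt <<s G >> f by exact/measurable_wrtP.
  split => //; apply/L2P; split; first exact: measurable_wrt_measurable.
  by rewrite -isq_nu.
by apply/L2P; split; [exact/measurable_wrtP|rewrite isq_nu].
Qed.

Let integral_nu (f : T -> R) A : measurable_wrt <<s G >> f ->
  mu.-integrable setT (EFin \o f) -> <<s G >> A ->
  (\int[nu]_(x in A) (f x)%:E = \int[mu]_(x in A) (f x)%:E)%E.
Proof.
move=> /measurable_wrtP mf fi GA.
rewrite (integral_pushforward measurable_toG)//; first exact/measurable_EFinP.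
by apply: integrableS fi => //; exact: sG.
Qed.

Let L2inner_nu (f g : T -> R) : L2 nu (f : TG -> R) -> L2 nu (g : TG -> R) ->
  L2inner nu (f : TG -> R) g = L2inner mu f g.
Proof.
move=> /[dup] lf /L2_nu[lf' mf] /[dup] lg /L2_nu[lg' mg].
congr fine; apply: integral_nu => //.
- apply/measurable_wrtP; apply: measurable_funM; exact/measurable_wrtP.
- exact: L2_mul_integrable.
- exact: (@measurableT _ TG).
Qed.

(** The space L2 of the restriction nu embeds isometrically, and it is complete; the
    projection theorem applies to its range. *)
Lemma condexp_projection f : L2 mu f ->
  exists Z, [/\ L2 mu Z, measurable_wrt <<s G >> Z &
    forall g, L2 mu g -> measurable_wrt <<s G >> g ->
      L2inner mu Z g = L2inner mu f g].
Proof.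
move=> lf.
pose j (x : L2hilbert nu) : L2hilbert mu := L2class mu (L2rep x : T -> R).
have lj (x : L2hilbert nu) : L2 mu (L2rep x : T -> R).
  by have /L2_nu[] := L2rep_L2 x.
have j_ip x y : ip (j x) (j y) = ip x y.
  rewrite ip_class; [|exact: lj|exact: lj].
  by rewrite -L2inner_nu//; exact: L2rep_L2.
have [z zf] := projection j_ip (L2class mu f).
exists (L2rep z); split; first exact: lj.
  by have /L2_nu[] := L2rep_L2 z.
move=> g lg mg; have lg' : L2 nu (g : TG -> R) by exact/L2_nu.
have jg : j (L2class nu (g : TG -> R)) = L2class mu g.
  apply/L2class_eq => //.
  have [N [mN N0 sN]] := L2rep_class lg'.
  by exists N; split => //; exact: sG.
have := zf (L2class nu (g : TG -> R)); rewrite jg ipBl => /eqP.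
by rewrite subr_eq0 !ip_class// => /eqP.
Qed.

Lemma L2_integrable f : L2 mu f -> mu.-integrable setT (EFin \o f).
Proof.
move=> lf; have := L2_mul_integrable lf (L2_indic measurableT).
by apply: eq_integrable => // x _; rewrite /= indicT mulr1.
Qed.

Lemma L2inner_indic f A : measurable A ->
  L2inner mu f (\1_A) = \int[mu]_(x in A) f x.
Proof.
move=> mA; rewrite Rintegral_mkcond; apply: eq_Rintegral => x _.
by rewrite patchE indicE; case: ifP; rewrite ?mulr1 ?mulr0.
Qed.

Lemma measurable_wrt_indic A : <<s G >> A -> measurable_wrt <<s G >> (\1_A : T -> R).
Proof. by move=> GA; apply/measurable_wrtP; exact: (@measurable_indic _ TG). Qed.

Lemma is_condexp_projection f Z : L2 mu f -> L2 mu Z ->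
  measurable_wrt <<s G >> Z ->
  (forall g, L2 mu g -> measurable_wrt <<s G >> g ->
    L2inner mu Z g = L2inner mu f g) ->
  is_condexp mu <<s G >> f Z.
Proof.
move=> lf lZ mZ Zf; split => //; first exact: L2_integrable.
move=> A GA; have mA := sG GA; rewrite -!L2inner_indic// Zf//.
  exact: L2_indic.
exact: measurable_wrt_indic.
Qed.

(** Both versions are integrable for the restricted measure nu and have the same
    integrals over all its measurable sets. *)
Lemma is_condexp_unique f Z Z' :
  is_condexp mu <<s G >> f Z -> is_condexp mu <<s G >> f Z' -> Z = Z' %[ae mu].
Proof.
move=> [mZ iZ ZE] [mZ' iZ' ZE'].
have : ae_eq nu setT (EFin \o (Z : TG -> R)) (EFin \o (Z' : TG -> R)).
  apply: integral_ae_eq => //.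
  - apply: (integrable_pushforward measurable_toG) => //.
    exact/measurable_EFinP/measurable_wrtP.
  - exact/measurable_EFinP/measurable_wrtP.
  move=> A _ GA; rewrite /= !integral_nu//.
  have iA W : mu.-integrable setT (EFin \o W) -> (\int[mu]_(x in A) (W x)%:E)%E =
      (\int[mu]_(x in A) W x)%:E.
    move=> iW; rewrite /Rintegral fineK//; apply: integrable_fin_num; first exact: sG.
    by apply: integrableS iW => //; exact: sG.
  by rewrite !iA// ZE// ZE'.
move=> [N [mN N0 sN]]; exists N; split => //; first exact: sG.
by move=> x h; apply: sN => /= h'; apply: h => _; have [] := h' I.
Qed.

(** The chosen version of the conditional expectation is a.e. equal to the
    orthogonal projection, so that it is square-integrable and characterized by inner
    products. *)
Lemma condexpP f : L2 mu f ->
  [/\ L2 mu (condexp mu <<s G >> f),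
    measurable_wrt <<s G >> (condexp mu <<s G >> f) &
    forall g, L2 mu g -> measurable_wrt <<s G >> g ->
      L2inner mu (condexp mu <<s G >> f) g = L2inner mu f g].
Proof.
move=> lf; have [Z [lZ mZ Zf]] := condexp_projection lf.
have cZ := is_condexp_projection lf lZ mZ Zf.
have cE : is_condexp mu <<s G >> f (condexp mu <<s G >> f).
  exact: (xgetPex (cst 0) (ex_intro _ Z cZ)).
have ZE := is_condexp_unique cZ cE.
have [mE _ _] := cE.
have lE : L2 mu (condexp mu <<s G >> f).
  by apply: L2_ae ZE lZ; exact: measurable_wrt_measurable.
split => // g lg mg; rewrite -Zf//.
by apply: ae_eq_L2inner => //; [exact: ae_eq_sym|exact: ae_eq_refl].
Qed.

(** The sets over which f has integral 0 form a Dynkin system that contains C, hence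
    the generated sigma-algebra. Then f is a conditional expectation of 0. *)
Lemma total_pi_system (C : set (set T)) f :
  setI_closed C -> C setT -> <<s C >> = <<s G >> ->
  L2 mu f -> measurable_wrt <<s G >> f ->
  (forall A, C A -> L2inner mu f \1_A = 0) -> f = cst 0 %[ae mu].
Proof.
move=> CI CT CG lf mf f0.
have fi := L2_integrable lf.
have fA A : <<s G >> A -> mu.-integrable A (EFin \o f).
  by move=> GA; apply: integrableS fi => //; exact: sG.
have ifE A : <<s G >> A -> (\int[mu]_(x in A) (f x)%:E)%E =
      (L2inner mu f \1_A)%:E.
  move=> GA; have mA := sG GA; rewrite L2inner_indic// /Rintegral fineK//.
  by apply: integrable_fin_num => //; exact: fA.
have f0T : (\int[mu]_(x in setT) (f x)%:E = 0)%E.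
  by rewrite ifE ?f0// -CG; exact: sub_gen_smallest.
have key A : <<s G >> A -> (\int[mu]_(x in A) (f x)%:E = 0)%E.
  move=> GA; rewrite -CG in GA.
  apply: (@dynkin_induction _ (g_sigma_algebraType C) C
     (fun A => (\int[mu]_(x in A) (f x)%:E = 0)%E)) => //.
  - by move=> B CB; rewrite ifE ?f0// -CG; exact: sub_gen_smallest.
  - move=> B mB B0.
    have GB : <<s G >> B by rewrite -CG.
    have := f0T; rewrite -(setUv B) (integral_setU mu (sG GB)).
    + by rewrite B0 add0e.
    + exact: measurableC (sG GB).
    + by rewrite setUv; apply/measurable_EFinP; exact: measurable_wrt_measurable.
    + by apply/disj_setPS; rewrite setICr.
  - move=> F mF tF F0.
    have GF n : <<s G >> (F n) by rewrite -CG; exact: mF.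
    rewrite integral_bigcup//; first by rewrite eseries0// => n _ _; exact: F0.
    + by move=> n; exact: (sG (GF n)).
    + apply: integrableS fi => //; apply: bigcup_measurable => n _.
      exact: (sG (GF n)).
apply: (@is_condexp_unique f f (cst 0)).
  by split.
split => [| |A GA].
- by apply/measurable_wrtP; exact: measurable_cst.
- exact: integrable0.
- by rewrite /Rintegral key// integral0.
Qed.

End SubSigmaAlgebra.

(** * Cylinder sets and independence *)

Section Cylinders.
Context d0 (Omega : measurableType d0) (R : realType) (P : probability Omega R).
Context (d : nat -> measure_display) (E : forall n, measurableType (d n)).
Variable X : forall n, {RV P >-> E n}.
Implicit Types (B C : forall k, set (E k)) (M : set nat) (n k : nat).

(** Cylinders are indexed by sequences of sets that are eventually the whole
    space. Padding with the whole space makes intersection and the restriction to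
    a set of coordinates act factor by factor. *)
Definition cylinder B : set Omega := \bigcap_k (X k @^-1` B k).

Definition rectangle n B :=
  (forall k, measurable (B k)) /\ (forall k, (n <= k)%N -> B k = setT).

Definition cap_rect B C : forall k, set (E k) := fun k => B k `&` C k.

Definition restr_rect M B : forall k, set (E k) :=
  fun k => if k \in M then B k else setT.

Lemma rectangle_cap n n' B C : rectangle n B -> rectangle n' C ->
  rectangle (maxn n n') (cap_rect B C).
Proof.
move=> [mB nB] [mC nC]; split=> k; first exact: measurableI.
by rewrite geq_max => /andP[nk n'k]; rewrite /cap_rect nB// nC// setIT.
Qed.

Lemma rectangle_restr n M B : rectangle n B -> rectangle n (restr_rect M B).
Proof.
move=> [mB nB]; split=> k; rewrite /restr_rect; case: ifP => // _.
exact: nB.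
Qed.

Lemma rectangle_le n n' B : (n <= n')%N -> rectangle n B -> rectangle n' B.
Proof. by move=> nn' [mB nB]; split=> // k n'k; rewrite nB// (leq_trans nn'). Qed.

Lemma cylinder_cap B C : cylinder (cap_rect B C) = cylinder B `&` cylinder C.
Proof.
apply/seteqP; split=> w; first by move=> h; split=> k _; have [] := h k I.
by move=> [hB hC] k _; split; [exact: hB|exact: hC].
Qed.

Definition cylinders M : set (set Omega) :=
  [set A | exists n B, rectangle n B /\ A = cylinder (restr_rect M B)].

Lemma restr_rect_cap M B C :
  cap_rect (restr_rect M B) (restr_rect M C) = restr_rect M (cap_rect B C).
Proof.
apply: functional_extensionality_dep => k.
by rewrite /cap_rect /restr_rect; case: ifP => // _; rewrite setIT.
Qed.

Lemma cylindersI M : setI_closed (cylinders M).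
Proof.
move=> _ _ [n [B [rB ->]]] [n' [C [rC ->]]]; exists (maxn n n'), (cap_rect B C).
by split; [exact: rectangle_cap|rewrite -cylinder_cap restr_rect_cap].
Qed.

Lemma cylindersT M : cylinders M setT.
Proof.
exists 0%N, (fun k => setT); split=> //; apply/seteqP; split => // w _ k _ /=.
by rewrite /restr_rect; case: ifP.
Qed.

(** In the nontrivial inclusion, a generator X_n^-1(A) is the cylinder with A in
    position n and whole spaces elsewhere. *)
Lemma sigma_cylinders M : <<s cylinders M >> = sigmaX X M.
Proof.
apply/seteqP; split.
  apply: smallest_sub; first exact: smallest_sigma_algebra.
  move=> _ [n [B [[mB nB] ->]]].
  apply: (@bigcapT_measurable _ (g_sigma_algebraType (gen X M))) => k.
  rewrite /restr_rect; have [kM|kM] := boolP (k \in M); last first.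
    by rewrite preimage_setT; exact: (@measurableT _ (g_sigma_algebraType (gen X M))).
  apply: sub_gen_smallest; exists k; first exact: set_mem.
  by exists (B k) => //; rewrite setTI.
apply: smallest_sub; first exact: smallest_sigma_algebra.
move=> _ [n nM [A mA <-]]; apply: sub_gen_smallest.
exists n.+1, (@dfwith _ (fun k => set (E k)) (fun k => setT) n A); split.
  split=> k; first by case: dfwithP.
  by case: dfwithP => // nn; rewrite ltnn in nn.
rewrite setTI; apply/seteqP; split=> w /=.
  move=> Aw k _ /=; rewrite /restr_rect; case: ifP => // _.
  by case: dfwithP.
by move=> /(_ n I) /=; rewrite /restr_rect mem_set// dfwithin.
Qed.

Hypothesis indX : independent_seq X.

Definition marginal k (A : set (E k)) : R := fine (P (X k @^-1` A)).

Lemma marginalT k : marginal (setT : set (E k)) = 1.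
Proof. by rewrite /marginal preimage_setT probability_setT. Qed.

Lemma marginal_cylinder n B : rectangle n B ->
  fine (P (cylinder B)) = \prod_(k < n) marginal (B k).
Proof.
move=> [mB nB].
have -> : cylinder B = \bigcap_(k in [set` iseg n]) (X k @^-1` B k).
  apply/seteqP; split=> w h k; first by move=> _; exact: h.
  move=> _; have [nk|kn] := leqP n k; first by rewrite nB.
  by apply: h; rewrite /= in_iseg.
rewrite indX//.
have -> : (\prod_(k <- iseg n) P (X k @^-1` B k) =
    \prod_(k <- iota 0 n) P (X k @^-1` B k))%E.
  apply: perm_big; apply: uniq_perm; rewrite ?fset_uniq ?iota_uniq// => k.
  by rewrite in_iseg mem_iota.
rewrite -(big_mkord xpredT (fun k => marginal (B k))) /index_iota subn0.
have -> : (\prod_(k <- iota 0 n) P (X k @^-1` B k) =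
    (\prod_(k <- iota 0 n) marginal (B k))%:E)%E.
  rewrite -prodEFin; apply: eq_bigr => k _; rewrite /marginal fineK//.
  by rewrite fin_num_measure// -[_ @^-1` _]setTI; exact: measurable_funP.
by [].
Qed.

End Cylinders.

(** * Conditional expectations given subfamilies of the sequence *)

Section CondExp.
Context d0 (Omega : measurableType d0) (R : realType) (P : probability Omega R).
Context (d : nat -> measure_display) (E : forall n, measurableType (d n)).
Variable X : forall n, {RV P >-> E n}.
Implicit Types (B C : forall k, set (E k)) (M : set nat) (n k : nat).

Local Notation mu := (PX X).
Local Notation H := (L2hilbert (PX X)).
Local Notation cl := (@L2class R _ (OmegaX X) (PX X) : (OmegaX X -> R) -> H).

Lemma sub_sigmaX M : sigmaX X M `<=` (measurable : set (set (OmegaX X))).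
Proof.
apply: smallest_sub; first exact: smallest_sigma_algebra.
by move=> A [n _ h]; apply: sub_gen_smallest; exists n.
Qed.

Lemma PX_fin : (mu setT < +oo)%E.
Proof.
have -> : mu setT = 1%E by exact: (probability_setT (PX X)).
exact: ltry.
Qed.

(** The closed subspace of classes with a representative that is measurable with
    respect to the variables with index in M. *)
Definition mclass M (x : H) :=
  exists f, [/\ L2 mu f, measurable_wrt (sigmaX X M) f & x = cl f].

Lemma mclass_lin M a x y : mclass M x -> mclass M y -> mclass M (a *: x + y).
Proof.
move=> [f [lf mf ->]] [g [lg mg ->]]; exists (fun w => a * f w + g w); split.
- exact: L2_lin.
- apply/measurable_wrtP; apply: measurable_funD; last exact/measurable_wrtP.
  by apply: measurable_funM => //; exact/measurable_wrtP.
- have e := L2classD (L2Z a lf) lg; rewrite (L2classZ a lf) in e.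
  exact: esym e.
Qed.

Lemma mclass_setT x : mclass setT x.
Proof.
exists (L2rep x); split; [exact: L2rep_L2| |by rewrite -{1}[x]L2repK].
by apply/measurable_wrtP; exact: L2_measurable (L2rep_L2 x).
Qed.

Lemma mclass_inj M x y : mclass M x -> mclass M y ->
  (forall z, mclass M z -> ip x z = ip y z) -> x = y.
Proof.
move=> Mx My xy; apply/eqP; rewrite -subr_eq0; apply/eqP/ip_eq0.
by rewrite ipBl !ipBr (xy _ Mx) (xy _ My) subrr.
Qed.

Definition condE M (x : H) : H := cl (cond M (L2rep x : OmegaX X -> R)).

Lemma condP M f : L2 mu f ->
  [/\ L2 mu (cond M f), measurable_wrt (sigmaX X M) (cond M f) &
    forall g, L2 mu g -> measurable_wrt (sigmaX X M) g ->
      L2inner mu (cond M f) g = L2inner mu f g].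
Proof. exact: (condexpP PX_fin (@sub_sigmaX M)). Qed.

Lemma cond_mclass M f : L2 mu f -> mclass M (cl (cond M f)).
Proof. by move=> /(condP M)[lc mc _]; exists (cond M f). Qed.

Lemma cond_ip M f y : L2 mu f -> mclass M y -> ip (cl (cond M f)) y = ip (cl f) y.
Proof.
move=> lf [g [lg mg ->]]; have [lc mc cE] := condP M lf.
by rewrite !ip_class// cE.
Qed.

Lemma condE_mclass M x : mclass M (condE M x).
Proof. by apply: cond_mclass; exact: L2rep_L2. Qed.

Lemma condE_ip M x y : mclass M y -> ip (condE M x) y = ip x y.
Proof. by move=> My; rewrite cond_ip ?L2repK//; exact: L2rep_L2. Qed.

Lemma condE_unique M x y : mclass M y ->
  (forall z, mclass M z -> ip y z = ip x z) -> condE M x = y.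
Proof.
move=> My yx; apply: (mclass_inj (condE_mclass M x)) => // z Mz.
by rewrite condE_ip// yx.
Qed.

Lemma condE_class M f : L2 mu f -> condE M (cl f) = cl (cond M f).
Proof.
by move=> lf; apply: condE_unique; [exact: cond_mclass|move=> z; exact: cond_ip].
Qed.

Lemma condE_fix M x : mclass M x -> condE M x = x.
Proof. by move=> Mx; exact: condE_unique. Qed.

Lemma condE_adj M : self_adjoint_map (condE M).
Proof.
move=> x y; rewrite -(condE_ip x (condE_mclass M y)) ipC.
by rewrite -(condE_ip y (condE_mclass M x)) ipC.
Qed.

Definition indic_class (A : set Omega) : H := cl (\1_A : OmegaX X -> R).

Lemma cylinder_sigma M n B : rectangle n B -> sigmaX X M (cylinder X (restr_rect M B)).
Proof.
by move=> rB; rewrite -sigma_cylinders; apply: sub_gen_smallest; exists n, B.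
Qed.

Lemma restr_rectT B : restr_rect setT B = B.
Proof.
by apply: functional_extensionality_dep => k; rewrite /restr_rect in_setT.
Qed.

Lemma cylinder_measurable n B : rectangle n B -> measurable (cylinder X B : set (OmegaX X)).
Proof. by rewrite -{2}[B]restr_rectT => /(cylinder_sigma (M := setT)). Qed.

Lemma L2_cylinder n B : rectangle n B -> L2 mu (\1_(cylinder X B) : OmegaX X -> R).
Proof. by move=> rB; apply: L2_indic; [exact: PX_fin|exact: cylinder_measurable rB]. Qed.

Lemma mclass_cylinder M n B : rectangle n B ->
  mclass M (indic_class (cylinder X (restr_rect M B))).
Proof.
move=> rB; exists (\1_(cylinder X (restr_rect M B))); split => //.
  exact: L2_cylinder (rectangle_restr M rB).
by apply: measurable_wrt_indic; exact: cylinder_sigma rB.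
Qed.

(** Cylinders form a pi-system that generates. *)
Lemma mclass_total M x : mclass M x ->
  (forall n B, rectangle n B ->
    ip x (indic_class (cylinder X (restr_rect M B))) = 0) -> x = 0.
Proof.
move=> [f [lf mf ->]] f0; rewrite -[RHS]L2class0.
apply/L2class_eq => //; first exact: L20.
apply: (total_pi_system PX_fin (@sub_sigmaX M) (cylindersI (X := X) (M := M))
  (cylindersT X M) (sigma_cylinders X M) lf mf).
move=> _ [n [B [rB ->]]]; rewrite -ip_class//; first exact: f0 rB.
exact: L2_cylinder (rectangle_restr M rB).
Qed.

Hypothesis indX : independent_seq X.

Lemma ip_cylinder n B C : rectangle n B -> rectangle n C ->
  ip (indic_class (cylinder X B)) (indic_class (cylinder X C)) =
  \prod_(k < n) marginal X (B k `&` C k).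
Proof.
move=> rB rC; rewrite ip_class; [|exact: L2_cylinder rB|exact: L2_cylinder rC].
rewrite L2inner_indic; last exact: cylinder_measurable rC.
rewrite -(marginal_cylinder indX (B := cap_rect B C)); last first.
  by rewrite -[n in rectangle n]maxnn; exact: rectangle_cap.
rewrite cylinder_cap /Rintegral; congr fine.
rewrite integral_indic//; last 2 first.
- exact: cylinder_measurable rC.
- exact: cylinder_measurable rB.
Qed.

(** The right-hand side is measurable with respect to M, and by independence it has
    the same inner products as the cylinder with all cylinders over M. *)
Lemma condE_cylinder M n B : rectangle n B ->
  condE M (indic_class (cylinder X B)) =
  (\prod_(k < n) (if val k \in M then 1 else marginal X (B k))) *:
  indic_class (cylinder X (restr_rect M B)).
Proof.
move=> rB; set c := \prod_(k < n) _.
have Mc : mclass M (c *: indic_class (cylinder X (restr_rect M B))).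
  rewrite -[_ *: _]addr0; apply: mclass_lin; first exact: mclass_cylinder rB.
  exists (cst 0); split; [exact: L20| |exact: L2class0].
  by apply/measurable_wrtP; exact: measurable_cst.
apply/eqP; rewrite -subr_eq0 -scaleN1r addrC; apply/eqP.
apply: (mclass_total (mclass_lin _ Mc (condE_mclass M _))) => n' C rC'.
set N := maxn n n'.
have {}rB' : rectangle N B by apply: rectangle_le rB; exact: leq_maxl.
have {}rC : rectangle N C by apply: rectangle_le rC'; exact: leq_maxr.
rewrite ipDl !ipZl condE_ip; last exact: mclass_cylinder rC.
rewrite !(@ip_cylinder N)//; try exact: rectangle_restr.
have -> : c = \prod_(k < N) (if val k \in M then 1 else marginal X (B k)).
  rewrite /c; have := leq_maxl n n'; rewrite -/N => nN.
  rewrite -(subnKC nN) big_split_ord/= [X in _ * X]big1 ?mulr1// => k _.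
  by case: ifP => // _; case: rB => _ ->; rewrite ?marginalT// leq_addr.
rewrite -big_split/= mulN1r addrC; apply/eqP; rewrite subr_eq0; apply/eqP.
apply: eq_bigr => k _; rewrite /restr_rect; case: ifP => _.
  by rewrite mul1r.
by rewrite setIT setTI marginalT mulr1.
Qed.

(** It suffices to compare inner products with cylinders, where both sides
    integrate out the factors with index outside A or outside A'. *)
Lemma condE_comp A A' x : condE A (condE A' x) = condE (A `&` A') x.
Proof.
apply/eqP; rewrite -subr_eq0 -scaleN1r addrC; apply/eqP.
apply: (mclass_total (mclass_setT _)) => n B rB; rewrite restr_rectT.
rewrite ipDl ipZl !condE_adj !(condE_cylinder _ rB) !(sadjZ (@condE_adj _)).
rewrite (condE_cylinder _ (rectangle_restr A rB)) scalerA !ipZr.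
rewrite -big_split/= mulN1r addrC.
have -> : restr_rect A' (restr_rect A B) = restr_rect (A `&` A') B.
  apply: functional_extensionality_dep => k; rewrite /restr_rect in_setI.
  by case: (k \in A); case: (k \in A').
apply/eqP; rewrite subr_eq0; apply/eqP; congr (_ * _).
apply: eq_bigr => k _; rewrite /restr_rect in_setI.
case: (val k \in A); case: (val k \in A') => /=; rewrite ?marginalT ?mulr1 ?mul1r//.
Qed.

(** A cylinder over the first n coordinates does not see the difference between x
    and its conditional expectation given these coordinates. *)
Lemma condE_total x : (forall n, condE `I_n x = 0) -> x = 0.
Proof.
move=> x0; apply: (mclass_total (mclass_setT x)) => n B rB; rewrite restr_rectT.
have -> : cylinder X B = cylinder X (restr_rect `I_n B).
  congr (cylinder X _); apply: functional_extensionality_dep => k; rewrite /restr_rect.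
  case: ifPn => // /negP; rewrite inE/= => /negP; rewrite -leqNgt.
  by case: rB => _ h /h.
by rewrite -(condE_ip x (mclass_cylinder _ rB)) x0 ip0l.
Qed.

End CondExp.

(** * The product of counting measure and a probability as a Hilbert sum *)

(** Tonelli's theorem below is applied with counting measure as the first factor, for
    which this supplies the required structure. *)
Lemma sfinite_counting (R : realType) : sfinite_measure (@counting nat R).
Proof. exact/sfinite_measure_sigma_finite/sigma_finite_counting. Qed.

HB.instance Definition _ (R : realType) :=
  @isSFinite.Build _ _ _ (@counting nat R) (sfinite_counting R).

Section CountingProduct.
Context (R : realType) d (T : measurableType d) (P : probability T R).
Let kP : {measure set (nat * T) -> \bar R} := (@counting nat R \x P)%E.
Local Notation H := (L2hilbert P).
Local Notation K := (L2hilbert kP).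
Implicit Types (u v : nat * T -> R) (k n : nat).

Definition slice k u : T -> R := fun w => u (k, w).

Lemma measurable_slice k u : measurable_fun setT u -> measurable_fun setT (slice k u).
Proof. by move=> mu; apply: (measurableT_comp mu); exact: pair1_measurable. Qed.

Lemma measurable_slices u : (forall k, measurable_fun setT (slice k u)) ->
  measurable_fun setT u.
Proof.
move=> mu _ B mB; rewrite setTI.
rewrite (_ : u @^-1` B = \bigcup_k ([set k] `*` (slice k u @^-1` B))).
  apply: bigcup_measurable => k _; apply: measurableX => //.
  by rewrite -[_ @^-1` _]setTI; exact: mu.
apply/seteqP; split=> [[k w] /= Bu|[k w] [j _ [/= -> Bu]]//].
by exists k.
Qed.

Lemma isq_slice u : measurable_fun setT u ->
  sq_integral kP u = (\sum_(k <oo) sq_integral P (slice k u))%E.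
Proof.
move=> mu; have mu2 : measurable_fun setT (fun z => (u z ^+ 2)%:E).
  by apply/measurable_EFinP; exact: measurable_funX.
have u0 z : (0 <= (u z ^+ 2)%:E)%E by rewrite lee_fin sqr_ge0.
have -> : sq_integral kP u = (\int[counting]_k sq_integral P (slice k u))%E.
  exact: (fubini_tonelli1 _ mu2 u0).
by rewrite ge0_integral_count// => k; exact: isq_ge0.
Qed.

Lemma isq_slice_le k u : measurable_fun setT u ->
  (sq_integral P (slice k u) <= sq_integral kP u)%E.
Proof.
move=> mu; rewrite isq_slice//.
apply: le_trans (nneseries_lim_ge k.+1 _); last by move=> n _ _; exact: isq_ge0.
by rewrite big_nat_recr//= leeDr//; apply: sume_ge0 => i _; exact: isq_ge0.
Qed.

Lemma L2_slice k u : L2 kP u -> L2 P (slice k u).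
Proof.
move=> /L2P[mu lu]; apply/L2P; split; first exact: measurable_slice.
exact: le_lt_trans (isq_slice_le k mu) lu.
Qed.

Lemma ae_slice k u v : L2 kP u -> L2 kP v -> u = v %[ae kP] ->
  slice k u = slice k v %[ae P].
Proof.
move=> lu lv uv; have luv := L2B lu lv.
have muv := L2_measurable luv.
have d0 : sq_integral kP (fun z => u z - v z) = 0%E.
  rewrite (ae_eq_isq muv (g := cst 0))//.
    by rewrite /sq_integral; under eq_integral do rewrite expr0n; exact: integral0.
  by apply: filterS uv => z /= h zI; rewrite h// subrr.
have : sq_integral P (slice k (fun z => u z - v z)) = 0%E.
  by apply/eqP; rewrite eq_le isq_ge0 andbT -d0 isq_slice_le.
move=> /(isq_eq0 (measurable_slice k muv)); apply: filterS => w /= h wI.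
by apply/eqP; rewrite -subr_eq0; apply/eqP; exact: h.
Qed.

(** Slices of a.e. equal functions are a.e. equal (ae_slice), which makes the
    coordinates independent of the representative. *)
Definition component k (x : K) : H := L2class P (slice k (L2rep x)).

Lemma component_class k u : L2 kP u ->
  component k (L2class kP u) = L2class P (slice k u).
Proof.
move=> lu; apply/L2class_eq; try exact: L2_slice.
  exact/L2_slice/L2rep_L2.
by apply: ae_slice => //; [exact: L2rep_L2|exact: L2rep_class].
Qed.

Lemma componentD k (x y : K) : component k (x + y) = component k x + component k y.
Proof.
elim/L2q_ind: x => u lu; elim/L2q_ind: y => v lv.
rewrite -L2classD// !component_class//; last exact: L2D.
by rewrite -[RHS]L2classD//; exact: L2_slice.
Qed.

Let component_sqr (x : K) :
  (fun n => \sum_(k < n) ip (component k x) (component k x)) @ \oo --> ip x x.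
Proof.
elim/L2q_ind: x => u lu; rewrite ip_class//.
have h : (fun n => \sum_(0 <= k < n) sq_integral P (slice k u))%E @ \oo --> sq_integral kP u.
  rewrite isq_slice; last exact: L2_measurable lu.
  by apply: is_cvg_nneseries => n _ _; exact: isq_ge0.
have hE n : (\sum_(0 <= k < n) sq_integral P (slice k u))%E =
    (\sum_(k < n) ip (component k (L2class kP u)) (component k (L2class kP u)))%:E.
  rewrite big_mkord -sumEFin; apply: eq_bigr => k _.
  rewrite component_class// ip_class; try exact: L2_slice.
  by rewrite isq_L2inner//; exact: L2_slice.
rewrite isq_L2inner// in h; have /fine_cvgP[_] := h.
by apply: eq_rcvg => // n; rewrite /= hE.
Qed.

(** Polarization of the formula for squared norms, which is Tonelli's theorem. *)
Lemma component_sum : hilbert_sum component.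
Proof.
move=> x y.
have h := rcvgZ 2^-1 (rcvgB (rcvgB (@component_sqr (x + y)) (@component_sqr x))
  (@component_sqr y)).
apply: eq_rcvg h => [n|]; last by rewrite ip_sqrD; field.
rewrite -!sumrB mulr_sumr; apply: eq_bigr => k _.
by rewrite componentD ip_sqrD; field.
Qed.

Lemma component_ex (s : nat -> H) (C : R) :
  (forall n, \sum_(k < n) ip (s k) (s k) <= C) ->
  exists x, forall k, component k x = s k.
Proof.
move=> sC; pose u (z : nat * T) := L2rep (s z.1) z.2.
have ls k : L2 P (slice k u) by exact: L2rep_L2 (s k).
have mu : measurable_fun setT u.
  by apply: measurable_slices => k; exact: L2_measurable (ls k).
have lu : L2 kP u.
  apply/L2P; split => //; rewrite isq_slice//; apply: le_lt_trans (ltry C).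
  apply: lime_le; first by apply: is_cvg_nneseries => n _ _; exact: isq_ge0.
  apply: nearW => n; rewrite big_mkord.
  have -> : (\sum_(k < n) sq_integral P (slice k u))%E = (\sum_(k < n) ip (s k) (s k))%:E.
    rewrite -sumEFin; apply: eq_bigr => k _.
    by rewrite isq_L2inner// -ip_class// -[in RHS](L2repK (s k)).
  by rewrite lee_fin.
exists (L2class kP u) => k; rewrite component_class//.
exact: (L2repK (s k)).
Qed.

End CountingProduct.

(** * The Malliavin operators and the Hoeffding spaces *)

Section Concrete.
Context d0 (Omega : measurableType d0) (R : realType) (P : probability Omega R).
Context (d : nat -> measure_display) (E : forall n, measurableType (d n)).
Variable X : forall n, {RV P >-> E n}.
Hypothesis indX : independent_seq X.

Local Notation mu := (PX X).
Local Notation H := (L2hilbert (PX X)).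
Local Notation K := (L2hilbert (kPX X)).
Local Notation cl := (@L2class R _ (OmegaX X) (PX X) : (OmegaX X -> R) -> H).
Local Notation Q := (@condE _ _ _ _ _ _ X).
Local Notation hoef := (hoef Q).

Let pr k : K -> H := @component R _ (OmegaX X) (PX X) k.

Let Qadj := @condE_adj _ _ _ _ _ _ X.
Let QI := @condE_comp _ _ _ _ _ _ X indX.
Let Qtotal := @condE_total _ _ _ _ _ _ X.

Let pr_sum : hilbert_sum pr.
Proof. exact: component_sum. Qed.

Let pr_ex (s : nat -> H) (C : R) :
  (forall n, \sum_(k < n) ip (s k) (s k) <= C) ->
  exists u, forall k, pr k u = s k.
Proof. exact: component_ex. Qed.

Lemma L2_malliavinDk k F : L2 mu F -> L2 mu (malliavinDk k F).
Proof. by move=> lF; have [lc _ _] := condP [set j | j != k] lF; exact: L2B. Qed.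

Lemma diffop_class k F : L2 mu F -> diffop Q k (cl F) = cl (malliavinDk k F).
Proof.
move=> lF; have [lc _ _] := condP [set j | j != k] lF.
by rewrite /diffop condE_class// -[LHS](L2classB lF lc).
Qed.

Lemma smoothP F : L2 mu F -> smooth F <-> exists n, Q `I_n (cl F) = cl F.
Proof.
move=> lF; split=> [[_ [n [F' [mF' FF']]]]|[n nF]].
  have lF' : L2 mu F'.
    apply: L2_ae FF' lF.
    exact: (measurable_wrt_measurable (T := OmegaX X) (@sub_sigmaX _ _ _ _ _ _ X `I_n) mF').
  exists n; apply: condE_fix; exists F'; split => //.
  exact/L2class_eq.
split => //; have [lc mc _] := condP `I_n lF.
exists n, (cond `I_n F); split => //.
by apply/(L2class_eq lF lc); rewrite -[LHS]nF condE_class.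
Qed.

Lemma malliavinD0E : malliavinD0 (X := X) = lift_graph (gradient0 Q pr).
Proof.
have kE k u F : L2 (kPX X) u -> L2 mu F ->
    (fun w => u (k, w)) = malliavinDk k F %[ae mu] <->
    pr k (L2class (kPX X) u) = diffop Q k (cl F).
  move=> lu lF; rewrite diffop_class// /pr component_class//.
  apply: iff_sym; apply: L2class_eq; first exact: (L2_slice k lu).
  exact: L2_malliavinDk.
apply/seteqP; split=> -[F u] /=.
  move=> [sF lu uF]; have lF : L2 mu F by case: sF.
  split => //; split; first exact/smoothP.
  by move=> k; apply/kE.
move=> [/= lF lu [/(smoothP lF) sF uF]]; split => // k.
exact/kE.
Qed.

(** Closure, adjoint and composition commute with the passage to classes, so that
    the graph of L is the one described by generatorE. *)
Lemma malliavinLE : malliavinL X = lift_graph (hoef_generator Q).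
Proof.
rewrite /malliavinL /malliavin_delta /malliavinD malliavinD0E closure_lift.
rewrite adjoint_lift; apply/seteqP; split=> -[F G] /=.
  move=> [u [/= lF lu Fu] [/= _ lG uG]].
  have {}lG : L2 mu G.
    by have := L2N lG; congr (L2 _ _); apply/funext => w; rewrite opprK.
  split => //=; apply/(generatorE Qadj QI Qtotal pr_sum pr_ex).
  by exists (L2class (kPX X) u) => //; rewrite -[- _](L2classN lG).
move=> [/= lF lG /(generatorE Qadj QI Qtotal pr_sum pr_ex)[u Fu uG]].
exists (L2rep u); first exact: lift_graph_r.
apply: lift_graph_l; first exact: L2N.
by rewrite [cl _](L2classN lG).
Qed.

Lemma L2class_sum (I : Type) (r : seq I) (p : pred I) (F : I -> OmegaX X -> R) :
  (forall i, L2 mu (F i)) ->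
  cl (fun w => \sum_(i <- r | p i) F i w) = \sum_(i <- r | p i) cl (F i).
Proof.
move=> lF; elim: r => [|i r IH].
  by rewrite big_nil -[RHS]L2class0; congr (cl _); apply/funext => w; rewrite big_nil.
rewrite big_cons; case: ifPn => pi.
  rewrite -IH -[RHS]L2classD//; last first.
    under eq_fun do rewrite -big_filter; exact: L2_sum.
  by congr (cl _); apply/funext => w; rewrite big_cons pi.
by rewrite -IH; congr (cl _); apply/funext => w; rewrite big_cons (negbTE pi).
Qed.

Lemma L2_hoeffding_component F M : L2 mu F -> L2 mu (hoeffding_component F M).
Proof.
by move=> lF; apply: L2_sum => L; apply: L2Z; have [] := condP [set` L] lF.
Qed.

Lemma hoeffding_component_class F M : L2 mu F ->
  cl (hoeffding_component F M) = hoef M (cl F).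
Proof.
move=> lF; have lc (L : {fset nat}) : L2 mu (cond [set` L] F).
  by have [] := condP [set` L] lF.
rewrite [LHS](L2class_sum (fpowerset M) predT) => [|L]; last exact: L2Z.
apply: eq_bigr => L _; rewrite condE_class//.
exact: L2classZ (lc L).
Qed.

(** The net in the definition has the classes of hoef_eigen_net as its values. *)
Lemma hoeffding_spaceE p :
  hoeffding_space X p = [set F | L2 mu F /\ hoef_eigen Q (- p%:R) (cl F)].
Proof.
pose S F (A : {fset {fset nat}}) : OmegaX X -> R := fun w =>
  \sum_(M <- A | #|` M| == p) hoeffding_component F M w.
have lS F A : L2 mu F -> L2 mu (S F A).
  move=> lF; rewrite /S; under eq_fun do rewrite -big_filter.
  by apply: L2_sum => M; exact: L2_hoeffding_component.
have clS F A : L2 mu F ->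
    cl (S F A) = \sum_(M <- A | #|` M| == p) hoef M (cl F).
  move=> lF; rewrite [LHS]L2class_sum => [|M]; last exact: L2_hoeffding_component.
  by apply: eq_bigr => M _; exact: hoeffding_component_class.
have key F : L2 mu F ->
    ((fun A => L2dist mu F (S F A)) @ totally --> 0%E) <->
    hoef_eigen Q (- p%:R) (cl F).
  move=> lF; apply: (iff_trans _ (iff_sym (hoef_eigen_net Qadj QI Qtotal p (cl F)))).
  have -> : (fun A => L2dist mu F (S F A)) = (fun A => L2dist mu (S F A) F).
    apply/funext => A; rewrite (L2distE lF (lS F A lF)) (L2distE (lS F A lF) lF).
    by rewrite ip_distC.
  have netE : (fun A => ip (cl (S F A) - cl F) (cl (S F A) - cl F)) =
      (fun A : {fset {fset nat}} =>
        let z := cl F - \sum_(M <- A | #|` M| == p) hoef M (cl F) in ip z z).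
    by apply/funext => A; rewrite ip_distC (clS F A lF).
  by rewrite -netE; exact: (L2dist_cvg0 _ (fun A => lS F A lF) lF).
by apply/seteqP; split=> F [lF hF]; split; [exact: lF|exact/key|exact: lF|exact/key].
Qed.

Lemma eigenspaceE l :
  op_eigenspace mu (malliavinL X) l = [set F | L2 mu F /\ hoef_eigen Q l (cl F)].
Proof.
rewrite /op_eigenspace malliavinLE shift_lift.
apply/seteqP; split=> F /=.
  move=> [/= lF _ [y Fy]]; rewrite L2class0 => /esym/eqP; rewrite subr_eq0 => /eqP yE.
  by split; [exact: lF|rewrite yE in Fy; exact: Fy].
move=> [lF eF]; split => //=; first exact: L20.
by exists (l *: cl F) => //; rewrite subrr.
Qed.

Lemma injective_shiftE l : injective_op mu (shift_op mu (malliavinL X) l) <->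
  forall x, hoef_eigen Q l x -> x = 0.
Proof.
rewrite malliavinLE shift_lift injective_lift; split=> [inj x lx|inj x y z].
  apply: (inj x 0 0); first by exists (l *: x) => //; rewrite subrr.
  exists 0; last by rewrite scaler0 subr0.
  by move=> M; rewrite (sadj0 (hoef_adj Qadj M)) scaler0.
move=> [u xu ->] [v yv uv]; apply/eqP; rewrite -subr_eq0; apply/eqP/inj => M.
have -> : l *: (x - y) = u - v.
  have -> : u = v - l *: y + l *: x by rewrite -uv subrK.
  by rewrite scalerBr -(addrA v) (addrC v) addrK addrC.
by rewrite !(sadjB (hoef_adj Qadj M)) xu yv scalerBr.
Qed.

Lemma surjective_shift l : (forall x, hoef_eigen Q l x -> x = 0) ->
  surjective_op mu (shift_op mu (malliavinL X) l).
Proof.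
move=> inj; rewrite malliavinLE shift_lift surjective_lift => z.
have [x [y [xy zE]]] := generator_surj Qadj QI Qtotal inj z.
by exists x, y.
Qed.

End Concrete.

Theorem proposition2p9 (d0 : measure_display) (Omega : measurableType d0)
    (R : realType) (P : probability Omega R)
    (d : nat -> measure_display) (E : forall n : nat, measurableType (d n))
    (X : forall n : nat, {RV P >-> E n}) (indX : independent_seq X) :
  [/\ self_adjoint (PX X) (malliavinL X),
      positive_op (PX X) (opp_op (malliavinL X)),
      op_spectrum (PX X) (malliavinL X) =
        op_point_spectrum (PX X) (malliavinL X),
      op_point_spectrum (PX X) (malliavinL X) `<=`
        [set - p%:R | p in [set: nat]] &
      forall p : nat, op_point_spectrum (PX X) (malliavinL X) (- p%:R) ->
        op_eigenspace (PX X) (malliavinL X) (- p%:R) = hoeffding_space X p].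
Proof.
have Qadj := @condE_adj _ _ _ _ _ _ X.
have QI := @condE_comp _ _ _ _ _ _ X indX.
have Qtotal := @condE_total _ _ _ _ _ _ X.
split.
- rewrite malliavinLE//; split.
    apply: densely_defined_lift => x e e0.
    have [z [y [zy ze]]] := generator_dense Qadj QI Qtotal x e0.
    by exists z, y.
  by rewrite adjoint_lift -generator_adj.
- move=> F G; rewrite /opp_op/= malliavinLE// => -[/= lF lG /generator_ge0].
  have {}lG : L2 (PX X) G.
    by have := L2N lG; congr (L2 _ _); apply/funext => w; rewrite opprK.
  move=> /(_ Qadj QI Qtotal).
  have e : L2class (PX X) (fun w => - G w) = - L2class (PX X) G := L2classN lG.
  by rewrite e opprK ip_class.
- apply/seteqP; split=> l h.
    move=> inj; apply: h; split => //.
    by apply: surjective_shift => //; exact/injective_shiftE.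
  by move=> [inj _].
- move=> l h; apply: contrapT => hl; apply: h; apply/injective_shiftE => //.
  move=> x; apply: (hoef_eigen0 Qadj Qtotal) => p.
  by apply/eqP => lp; apply: hl; exists p.
- by move=> p _; rewrite eigenspaceE// hoeffding_spaceE.
Qed.
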